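(* Let $g\ge 0$ be a fixed integer, $m=g+1$, and let $Z_1,Z_2,\dots$ be independent with common distribution $P$ on $\mathcal{X}\times\mathcal{Y}$. Assume that $\Phi$ is $P^{\otimes(g+1)}$-almost surely bounded and that $\kappa_c\ne\Delta^2$ for all $1\le c\le g+1$ (non-degeneracy). Let $\widehat\Delta,\widehat{\kappa_1},\widehat{\Delta^2},\hat v$ be the statistics computed from $Z_1,\dots,Z_n$ ($n\ge 2g+2$) defined in the context. Let $u(n)$ be any one of the following expressions: (1) $u(n)=(g+1)^2(\kappa_1-\Delta^2)/n$; (2) $u(n)=(g+1)^2(\widehat{\kappa_1}-\widehat{\Delta^2})/n$; (3) $u(n)=\hat v$. Then $(\widehat\Delta-\Delta)\,u(n)^{-1/2}$ converges in distribution to the standard normal distribution $\mathcal{N}(0,1)$ as $n\to\infty$ with $g$ fixed.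
   Context: Setting. $\mathcal{X}=\mathbb{R}^{r-1}$ is the predictor space, $\mathcal{Y}\subset\mathbb{R}$ the response space, and $P$ is a probability distribution on $\mathcal{X}\times\mathcal{Y}\subset\mathbb{R}^r$ with discrete marginal on $\mathcal{Y}$. $L:\mathcal{Y}\times\mathcal{Y}\to\mathbb{R}$ is a measurable loss function. $M,M'$ are two deterministic learning algorithms, given by measurable functions $f_M,f_{M'}:(\mathcal{X}\times\mathcal{Y})^{g}\times\mathcal{X}\to\mathcal{Y}$ symmetric in the first $g$ arguments. For $z_i=(x_i,y_i)$, $$\Phi(z_1,\dots,z_g;z_{g+1})=L(f_M(z_1,\dots,z_g;x_{g+1}),y_{g+1})-L(f_{M'}(z_1,\dots,z_g;x_{g+1}),y_{g+1}),$$ $$\Phi_0(z_1,\dots,z_{g+1})=\frac1{g+1}\sum_{i=1}^{g+1}\Phi(z_1,\dots,z_{i-1},z_{i+1},\dots,z_{g+1};z_i).$$ Put $\Delta=\mathbb{E}_{P^{\otimes(g+1)}}(\Phi)=\mathbb{E}(\Phi_0)$ and $m=g+1$. U-statistics. For a (not necessarily symmetric) measurable function $\Psi$ of $k\le n$ arguments, the U-statistic associated to its symmetrization is the average of $\Psi(Z_{i_1},\dots,Z_{i_k})$ over all ordered $k$-tuples $(i_1,\dots,i_k)$ of pairwise distinct indices in $\{1,\dots,n\}$. $\widehat{\Delta}=\binom{n}{g+1}^{-1}\sum_{S}\Phi_0((Z_i)_{i\in S})$, the sum over all $(g+1)$-element subsets $S\subset\{1,\dots,n\}$. For $1\le c\le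 m$, $$\kappa_c=\int\cdots\int\Phi_0(z_1,\dots,z_m)\,\Phi_0(z_{m-c+1},\dots,z_{2m-c})\,dP(z_1)\cdots dP(z_{2m-c}),$$ $$\Delta^2=\int\cdots\int\Phi_0(z_1,\dots,z_m)\,\Phi_0(z_{m+1},\dots,z_{2m})\,dP(z_1)\cdots dP(z_{2m}).$$ $\widehat{\kappa_c}$ (based on $2m-c$ arguments) and $\widehat{\Delta^2}$ (based on $2m$ arguments) are the U-statistics from $Z_1,\dots,Z_n$ associated to the symmetrizations of the integrands in these two formulas. With $\alpha_c=\binom{m}{c}\binom{n-m}{m-c}/\binom{n}{m}$ (the hypergeometric mass function of $\mathcal{H}(n,m,m)$ at $c$), $$\hat v=\sum_{c=1}^{m}\alpha_c\,\widehat{\kappa_c}-(1-\alpha_0)\,\widehat{\Delta^2}.$$ Convention: on the event $u(n)\le 0$, the value of $u(n)^{-1/2}$ is assigned arbitrarily (e.g. $0$). *)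

(* Defs.v *)
From HB Require Import structures.
From mathcomp Require Import all_boot all_order all_fingroup all_algebra finmap.
From mathcomp Require Import all_classical all_reals all_analysis.

Set Implicit Arguments.
Unset Strict Implicit.
Unset Printing Implicit Defensive.

Import Order.TTheory GRing.Theory Num.Theory.
Import numFieldNormedType.Exports.

Local Open Scope classical_set_scope.
Local Open Scope ring_scope.

(* A subset Y of the line as a measurable type, with the trace of the Borel
   sigma-algebra.  The element y0 only serves to make the type pointed. *)
Definition pointed_subset (R : realType) (Y : set R) (y0 : Y) : Type := Y.

HB.instance Definition _ (R : realType) (Y : set R) (y0 : Y) :=
  Choice.on (pointed_subset y0).
HB.instance Definition _ (R : realType) (Y : set R) (y0 : Y) :=
  isPointed.Build (pointed_subset y0) y0.

Definition subset_val (R : realType) (Y : set R) (y0 : Y)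
  (y : pointed_subset y0) : R := set_val y.

Definition response (R : realType) (Y : set R) (y0 : Y) : Type :=
  g_sigma_algebra_preimageType (@subset_val R Y y0).

HB.instance Definition _ (R : realType) (Y : set R) (y0 : Y) :=
  Measurable.copy (response y0)
    (g_sigma_algebra_preimageType (@subset_val R Y y0)).

(* The marginal on the second factor has a countable carrier. *)
Definition discrete_snd (R : realType) (dX dY : measure_display)
    (X : measurableType dX) (Y : measurableType dY)
    (P : probability (X * Y)%type R) : Prop :=
  exists C : set Y, countable C /\ P (snd @^-1` C) = 1%E.

Section product_power.
Context (d : measure_display) (T : measurableType d) (R : realType).

Definition tuple_cons (n : nat) (x : T * n.-tuple T) : n.+1.-tuple T :=
  [tuple of x.1 :: x.2].

Lemma measurable_tuple_cons (n : nat) :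
  measurable_fun [set: T * n.-tuple T] (@tuple_cons n).
Proof. exact: measurable_cons. Qed.

HB.instance Definition _ (n : nat) :=
  isMeasurableFun.Build _ _ (T * n.-tuple T)%type (n.+1.-tuple T)
    (@tuple_cons n) (@measurable_tuple_cons n).

Fixpoint product_power (P : probability T R) (n : nat) :
    probability (n.-tuple T) R :=
  match n return probability (n.-tuple T) R with
  | 0%N => \d_ ([tuple] : 0.-tuple T)
  | k.+1 => distribution (P \x product_power P k)%E (@tuple_cons k)
  end.

End product_power.

Section random_sequences.
Context (d dT : measure_display) (Omega : measurableType d)
  (T : measurableType dT) (R : realType) (Pr : probability Omega R).

Definition independent (Z : nat -> {RV Pr >-> T}) : Prop :=
  forall (J : {fset nat}) (A : nat -> set T), (forall i, measurable (A i)) ->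
    Pr (\bigcap_(i in [set` J]) (Z i @^-1` A i))
      = (\prod_(i <- J) Pr (Z i @^-1` A i))%E.

Definition identically_distributed (P : probability T R)
    (Z : nat -> {RV Pr >-> T}) : Prop :=
  forall (i : nat) (A : set T), measurable A -> distribution Pr (Z i) A = P A.

(* Convergence of the distribution functions at every continuity point of the
   limiting one. *)
Definition cvg_in_distribution (X : nat -> Omega -> R)
    (mu : probability (measurableTypeR R) R) : Prop :=
  (forall n, measurable_fun [set: Omega] (X n)) /\
  forall x : R, {for x, continuous (fun y : R => mu `]-oo, y]%classic)} ->
    Pr [set w | X n w <= x] @[n --> \oo] --> mu `]-oo, x]%classic.

End random_sequences.

Section learning.
Context (R : realType) (dX dY : measure_display).
Context (X : measurableType dX) (Y : measurableType dY) (g : nat).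

Definition symmetric_learner (f : g.-tuple (X * Y) * X -> Y) : Prop :=
  forall (s : 'S_g) (z : g.-tuple (X * Y)) (x : X),
    f ([tuple tnth z (s i) | i < g], x) = f (z, x).

Definition loss_difference (L : Y * Y -> R)
    (fM fM' : g.-tuple (X * Y) * X -> Y)
    (learn : g.-tuple (X * Y)) (test : X * Y) : R :=
  L (fM (learn, test.1), test.2) - L (fM' (learn, test.1), test.2).

End learning.

Section U_statistics.
Context (d : measure_display) (T : measurableType d) (R : realType).

(* The first k entries of s; all uses below have k <= size s, so that the
   default value [point] is never reached. *)
Definition first_of (k : nat) (s : seq T) : k.-tuple T :=
  [tuple nth point s i | i < k].

(* The average of psi over all k-tuples of distinct observations among
   z 0, ..., z n.-1 (equal to 0 if n < k). *)
Definition U_stat (k : nat) (psi : k.-tuple T -> R) (n : nat) (z : nat -> T) :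
    R :=
  (\sum_(s : k.-tuple 'I_n | uniq s) psi [tuple z (tnth s i) | i < k])
    / #|[pred s : k.-tuple 'I_n | uniq s]|%:R.

Section kernel.
Context (g : nat) (Phi : g.-tuple T -> T -> R) (P : probability T R).
Let m := g.+1.

Definition leave_out (i : 'I_m) (z : m.-tuple T) : g.-tuple T :=
  [tuple tnth z (lift i j) | j < g].

(* Phi as a function of m arguments: the last one is the test observation. *)
Definition Phi_tuple (z : m.-tuple T) : R :=
  Phi (leave_out ord_max z) (tnth z ord_max).

Definition as_bounded : Prop :=
  exists B : R, {ae product_power P m, forall z, `|Phi_tuple z| <= B}.

Definition Phi0 (z : m.-tuple T) : R :=
  m%:R^-1 * \sum_(i < m) Phi (leave_out i z) (tnth z i).

Definition Delta : R := \int[product_power P m]_z Phi_tuple z.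

(* Phi0(z_1,...,z_m) * Phi0(z_(m-c+1),...,z_(2m-c)): the two blocks share c
   arguments. *)
Definition overlap (c : nat) (z : (2 * m - c).-tuple T) : R :=
  Phi0 (first_of m z) * Phi0 (first_of m (drop (m - c) z)).

Definition kappa (c : nat) : R :=
  \int[product_power P (2 * m - c)]_z overlap z.

(* For c = 0 the two blocks are disjoint, and [kappa] is the 2m-fold integral
   that represents Delta ^+ 2. *)
Definition Delta_sq : R := kappa 0.

Definition Delta_hat (n : nat) (z : nat -> T) : R :=
  'C(n, m)%:R^-1 * \sum_(S : {set 'I_n} | #|S| == m)
    Phi0 (first_of m [seq z i | i : 'I_n in S]).

Definition kappa_hat (c n : nat) (z : nat -> T) : R :=
  U_stat (@overlap c) n z.

Definition Delta_sq_hat (n : nat) (z : nat -> T) : R := kappa_hat 0 n z.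

Definition alpha (n c : nat) : R :=
  ('C(m, c) * 'C(n - m, m - c))%:R / 'C(n, m)%:R.

Definition v_hat (n : nat) (z : nat -> T) : R :=
  \sum_(1 <= c < m.+1) alpha n c * kappa_hat c n z
    - (1 - alpha n 0) * Delta_sq_hat n z.

Definition u_exact (n : nat) (z : nat -> T) : R :=
  m%:R ^+ 2 * (kappa 1 - Delta_sq) / n%:R.

Definition u_plugin (n : nat) (z : nat -> T) : R :=
  m%:R ^+ 2 * (kappa_hat 1 n z - Delta_sq_hat n z) / n%:R.

End kernel.
End U_statistics.

(* Main.v *)
From HB Require Import structures.
Require Import Defs.
From mathcomp Require Import all_boot all_order all_fingroup all_algebra finmap.
From mathcomp Require Import all_classical all_reals all_analysis.
From mathcomp Require Import measurable_realfun ring lra zify.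
Import Order.TTheory GRing.Theory Num.Theory.
Import numFieldNormedType.Exports.
Local Open Scope classical_set_scope.
Local Open Scope ring_scope.

(** Write [phi] for the symmetric kernel [Phi0].  Up to a null set [Phi] may be
    replaced by a version truncated at its essential bound, so all kernels are
    bounded.

    Hoeffding projection: with [h x = E phi (x, Z_2, ..., Z_m) - Delta], the
    kernel [phi - Delta - \sum_i h (z_i)] has zero mean given any single
    argument.  Hence two of its values on index tuples sharing at most one index
    are uncorrelated; as only a fraction O(n^-2) of the pairs of index tuples
    share two indices, its U-statistic is O(n^-1) in L^2, and
    [Delta_hat - Delta] behaves like [m / n * \sum_j h (Z_j)].  The variance of
    [h] is [kappa 1 - Delta_sq], which is nonzero by non-degeneracy.

    Central limit theorem: the test function [(t, y) |-> N (y / sqrt t)], with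
    [N] the normal distribution function, solves the heat equation and has
    bounded derivatives for [t >= eps].  Adding one summand of variance [1 / n]
    therefore changes its expectation as increasing [t] by [1 / n] does, up to
    O(n^(-3/2)).  After n steps E N ((y - S_n) / sqrt eps) is within O(n^(-1/2))
    of N (y / sqrt (1 + eps)), and eps -> 0 gives the convergence of the
    distribution functions.

    Studentization: the same counting argument gives a weak law of large numbers
    for the estimators of the [kappa c].  In [v_hat], n times the hypergeometric
    weight [alpha n c] tends to [m ^ 2] for [c = 1] and to 0 for [c > 1], so
    [n * u n] tends to [m ^ 2 * (kappa 1 - Delta_sq)] in probability in all
    three cases, and Slutsky's lemma applies. *)

Set Implicit Arguments.
Unset Strict Implicit.
Unset Printing Implicit Defensive.

(** * Integrals of bounded measurable functions *)

Section bounded_measurable.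
Context (R : realType).

(** This class is stable under the operations used below and integrable for every probability
    measure, so integrability never has to be tracked separately. *)
Definition bmf d (T : measurableType d) (f : T -> R) : Prop :=
  measurable_fun [set: T] f /\ exists B, forall x, `|f x| <= B.

Context d (T : measurableType d).
Implicit Types f g : T -> R.

Lemma bmf_ub f : bmf f -> exists2 B, 0 < B & forall x, `|f x| <= B.
Proof.
move=> [_ [B fB]]; exists (Num.max B 1); first by rewrite lt_max ltr01 orbT.
by move=> x; rewrite le_max fB.
Qed.

Lemma bmf_cst (c : R) : bmf (fun _ : T => c).
Proof. by split => //; exists `|c|. Qed.

Lemma bmfD f g : bmf f -> bmf g -> bmf (fun x => f x + g x).
Proof.
move=> [mf [B fB]] [mg [C gC]]; split; first exact: measurable_funD.
by exists (B + C) => x; rewrite (le_trans (ler_normD _ _))// lerD.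
Qed.

Lemma bmfM f g : bmf f -> bmf g -> bmf (fun x => f x * g x).
Proof.
move=> [mf [B fB]] [mg [C gC]]; split; first exact: measurable_funM.
by exists (B * C) => x; rewrite normrM ler_pM.
Qed.

Lemma bmfN f : bmf f -> bmf (fun x => - f x).
Proof.
move=> [mf [B fB]]; split; first exact: measurableT_comp.
by exists B => x; rewrite normrN.
Qed.

Lemma bmfB f g : bmf f -> bmf g -> bmf (fun x => f x - g x).
Proof. by move=> bf bg; apply: bmfD => //; exact: bmfN. Qed.

Lemma bmf_sum (I : Type) (r : seq I) (p : pred I) (F : I -> T -> R) :
  (forall i, p i -> bmf (F i)) -> bmf (fun x => \sum_(i <- r | p i) F i x).
Proof.
move=> bF; elim: r => [|i r IH].
  by under eq_fun do rewrite big_nil; exact: bmf_cst.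
under eq_fun do rewrite big_cons.
by case: (boolP (p i)) => // pi; apply: bmfD => //; exact: bF.
Qed.

Lemma bmf_comp d' (U : measurableType d') (h : U -> T) f :
  measurable_fun [set: U] h -> bmf f -> bmf (f \o h).
Proof.
move=> mh [mf [B fB]]; split; first exact: measurableT_comp.
by exists B => x; exact: fB.
Qed.

Lemma measurable_gt_set f (c : R) : measurable_fun [set: T] f ->
  measurable [set x | c < f x].
Proof.
move=> mf; rewrite [X in measurable X](_ : _ = setT `&` f @^-1` `]c, +oo[).
  exact: mf.
by apply/seteqP; split=> x /=; rewrite in_itv/= andbT//= => -[].
Qed.

Lemma measurable_le_set f (c : R) : measurable_fun [set: T] f ->
  measurable [set x | f x <= c].
Proof.
move=> mf; rewrite [X in measurable X](_ : _ = setT `&` f @^-1` `]-oo, c]).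
  exact: mf.
by apply/seteqP; split=> x /=; rewrite in_itv//= => -[].
Qed.

Context (mu : probability T R).

Lemma bmf_integrable f : bmf f -> mu.-integrable [set: T] (EFin \o f).
Proof.
move=> [mf [B fB]].
apply: (@le_integrable _ _ _ _ _ _ _ (EFin \o cst B)) => //.
- exact/measurable_EFinP.
- by move=> x _ /=; rewrite lee_fin (le_trans (fB x))// ler_norm.
- by apply: finite_measure_integrable_cst.
Qed.

Lemma bmf_intD f g : bmf f -> bmf g ->
  \int[mu]_x (f x + g x) = \int[mu]_x f x + \int[mu]_x g x.
Proof. by move=> bf bg; rewrite RintegralD//; exact: bmf_integrable. Qed.

Lemma bmf_intB f g : bmf f -> bmf g ->
  \int[mu]_x (f x - g x) = \int[mu]_x f x - \int[mu]_x g x.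
Proof. by move=> bf bg; rewrite RintegralB//; exact: bmf_integrable. Qed.

Lemma bmf_intZ c f : bmf f -> \int[mu]_x (c * f x) = c * \int[mu]_x f x.
Proof. by move=> bf; rewrite RintegralZl//; exact: bmf_integrable. Qed.

Lemma probability_int_cst (c : R) : \int[mu]_x c = c.
Proof.
rewrite Rintegral_cst//= [X in fine X](_ : _ = 1%E) ?mulr1//.
exact: probability_setT.
Qed.

Lemma bmf_int_sum (I : Type) (r : seq I) (p : pred I) (F : I -> T -> R) :
  (forall i, p i -> bmf (F i)) ->
  \int[mu]_x (\sum_(i <- r | p i) F i x) =
  \sum_(i <- r | p i) \int[mu]_x F i x.
Proof.
move=> bF; elim: r => [|i r IH].
  by under eq_Rintegral do rewrite big_nil; rewrite big_nil probability_int_cst.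
under eq_Rintegral do rewrite big_cons; rewrite big_cons -IH.
case: (boolP (p i)) => // pi; rewrite bmf_intD//; first exact: bF.
exact: bmf_sum.
Qed.

Lemma bmf_le_int f g : bmf f -> bmf g -> (forall x, f x <= g x) ->
  \int[mu]_x f x <= \int[mu]_x g x.
Proof.
by move=> bf bg fg; apply: le_Rintegral => //; exact: bmf_integrable.
Qed.

Lemma bmf_norm_int_le f (B : R) : bmf f -> (forall x, `|f x| <= B) ->
  `|\int[mu]_x f x| <= B.
Proof.
move=> bf fB; have fB' x : - B <= f x <= B by rewrite -ler_norml.
rewrite ler_norml -{1}(probability_int_cst (- B)) -{2}(probability_int_cst B).
apply/andP; split; apply: bmf_le_int => //; try exact: bmf_cst.
- by move=> x; case/andP: (fB' x).
- by move=> x; case/andP: (fB' x).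
Qed.

Lemma ae_eq_Rintegral f g : measurable_fun [set: T] f ->
  measurable_fun [set: T] g -> {ae mu, forall x, f x = g x} ->
  \int[mu]_x f x = \int[mu]_x g x.
Proof.
move=> mf mg fg; congr fine; apply: ae_eq_integral => //.
- exact/measurable_EFinP.
- exact/measurable_EFinP.
- by apply: filterS fg => x /= -> _.
Qed.

Lemma bmf_indic (A : set T) : measurable A -> bmf (\1_A : T -> R).
Proof.
move=> mA; split; first exact: measurable_indic.
by exists 1 => x; rewrite indicE ger0_norm// lern1 leq_b1.
Qed.

Lemma fine_measure_int (A : set T) : measurable A ->
  fine (mu A) = \int[mu]_x \1_A x.
Proof. by move=> mA; rewrite /Rintegral integral_indic// setIT. Qed.

(** Chebyshev's inequality: the indicator of the event is pointwise at most [e ^- 2 * f ^+ 2]. *)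
Lemma markov_sqr f (e : R) : bmf f -> 0 < e ->
  fine (mu [set x | e < `|f x|]) <= e ^- 2 * \int[mu]_x (f x ^+ 2).
Proof.
move=> bf e0; set A := [set x | _].
have mA : measurable A.
  by apply: measurable_gt_set; apply: measurableT_comp => //; case: bf.
rewrite fine_measure_int//; have bA := bmf_indic mA.
rewrite -bmf_intZ//; last by apply: bmfM.
apply: bmf_le_int => //.
  by apply: bmfM; [exact: bmf_cst|apply: bmfM].
move=> x; rewrite indicE; case: (boolP (x \in A)) => [|_] /=; last first.
  by rewrite mulr_ge0 ?sqr_ge0// invr_ge0 sqr_ge0.
rewrite inE /A /= => efx.
rewrite ler_pdivlMl ?exprn_gt0// mulr1 -[leRHS]real_normK ?num_real//.
by rewrite ler_sqr ?nnegrE ?(ltW efx) ?(ltW e0).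
Qed.

End bounded_measurable.

(** * Fubini's theorem for bounded functions *)

Section bounded_fubini.
Context (R : realType) d1 d2 (T1 : measurableType d1) (T2 : measurableType d2).
Context (mu : probability T1 R) (nu : probability T2 R).
Variable F : T1 * T2 -> R.
Hypothesis bF : bmf F.

Lemma bmf_section x : bmf (fun y => F (x, y)).
Proof.
apply: (@bmf_comp _ _ _ _ _ (fun y => (x, y)) F) => //.
exact: measurable_fun_pair.
Qed.

Lemma bmf_fubini_F : bmf (fun x => \int[nu]_y F (x, y)).
Proof.
split; last first.
  case: bF => _ [B FB]; exists B => x.
  by apply: bmf_norm_int_le => //; exact: bmf_section.
have iF := @bmf_integrable _ _ _ (mu \x nu)%E _ bF.
have := measurable_fubini_F iF.
rewrite /fubini_F => mF.
apply/measurable_EFinP; apply: eq_measurable_fun mF => x _ /=.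
rewrite /Rintegral fineK//; apply: integrable_fin_num => //.
exact/bmf_integrable/bmf_section.
Qed.

Lemma bmf_fubini :
  \int[(mu \x nu)%E]_z F z = \int[mu]_x \int[nu]_y F (x, y).
Proof.
have iF := @bmf_integrable _ _ _ (mu \x nu)%E _ bF.
rewrite /Rintegral; congr fine.
rewrite -(integral12_prod_meas1 iF); apply: eq_integral => x _.
rewrite /fubini_F /= fineK//; apply: integrable_fin_num => //.
exact/bmf_integrable/bmf_section.
Qed.

End bounded_fubini.

(** * Joint law of distinct observations *)

Section observations.
Context d (T : measurableType d).

(** Labels are plain natural numbers, so statements about joint laws do not depend on a sample
    size. *)
Definition obs k (s : k.-tuple nat) (z : nat -> T) : k.-tuple T :=
  [tuple z (tnth s i) | i < k].

Lemma obs_cons k x (s : k.-tuple nat) z :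
  obs [tuple of x :: s] z = tuple_cons (z x, obs s z).
Proof.
apply: eq_from_tnth => i; rewrite tnth_mktuple.
by case: (unliftP ord0 i) => [j ->|->]; rewrite ?tnthS ?tnth0// tnth_mktuple.
Qed.

Lemma val_obs k (s : k.-tuple nat) z : obs s z = [seq z x | x <- s] :> seq T.
Proof.
by rewrite -[in RHS](map_tnth_enum s) -map_comp.
Qed.

Context (R : realType) (P : probability T R).

(* Boxes are indexed by the labels of the observations rather than by their
   positions, so that one family [A] describes constraints on both members of
   a pair of tuples of observations. *)
Definition box k (s : k.-tuple nat) (A : nat -> set T) : set (k.-tuple T) :=
  [set z | forall i, A (tnth s i) (tnth z i)].

Lemma measurable_box k (s : k.-tuple nat) A : (forall i, measurable (A i)) ->
  measurable (box s A).
Proof.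
move=> mA; rewrite (_ : box s A =
  \big[setI/setT]_(i < k) ((@tnth k T)^~ i @^-1` A (tnth s i))).
  apply: bigsetI_measurable => i _; rewrite -[X in measurable X]setTI.
  exact: measurable_tnth.
rewrite -bigcap_seq; apply/seteqP; split=> z /= zA.
  by move=> i _; exact: zA.
by move=> i; apply: zA; rewrite /= mem_index_enum.
Qed.

Lemma product_power_box k (s : k.-tuple nat) A :
  (forall i, measurable (A i)) ->
  product_power P k (box s A) = (\prod_(x <- s) P (A x))%E.
Proof.
move=> mA; elim: k s => [s|k IH s].
  rewrite tuple0 big_nil /= (_ : box _ _ = setT) ?diracT//.
  by apply/seteqP; split=> z //= _ [].
rewrite (tuple_eta s); set x := thead s; set t := behead_tuple s.
rewrite big_cons /= -(IH t) -product_measure1E//; last exact: measurable_box.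
rewrite /distribution /pushforward; congr ((_ \x _)%E _).
apply/seteqP; split=> -[y z] /= h.
  split; first by have := h ord0; rewrite !tnth0.
  by move=> i; have := h (lift ord0 i); rewrite !tnthS.
case: h => /= yA zA i; case: (unliftP ord0 i) => [j ->|->].
  by rewrite !tnthS.
by rewrite !tnth0.
Qed.

Definition boxes k l (s : k.-tuple nat) (t : l.-tuple nat) :
    set (set (k.-tuple T * l.-tuple T)) :=
  [set B | exists2 A : nat -> set T, (forall i, measurable (A i)) &
     B = box s A `*` box t A].

(** As the labels are distinct, constraining a single coordinate is a box: the family is [B] at its
    label and the full set elsewhere. Hence every coordinate is measurable for the sigma-algebra
    generated by the boxes. *)
Lemma boxes_generate k l (s : k.-tuple nat) (t : l.-tuple nat) :
  uniq (s ++ t) -> measurable = <<s boxes s t >>.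
Proof.
move=> ust; apply/seteqP; split; last first.
  apply: smallest_sub; first exact: sigma_algebra_measurable.
  by move=> _ [A mA ->]; apply: measurableX; exact: measurable_box.
pose G := g_sigma_algebraType (boxes s t).
have coord (x : nat) (B : set T) : measurable B ->
    <<s boxes s t >> (box s (fun y => if y == x then B else setT) `*`
                      box t (fun y => if y == x then B else setT)).
  move=> mB; apply: sub_sigma_algebra.
  exists (fun y => if y == x then B else setT) => //.
  by move=> i; case: ifP.
have mf1 : measurable_fun [set: G] (fst : G -> k.-tuple T).
  apply/measurable_fun_tnthP => i _ B mB; rewrite setTI.
  rewrite [X in measurable X](_ : _ =
    (box s (fun y => if y == tnth s i then B else setT) `*`
     box t (fun y => if y == tnth s i then B else setT))); last first.
    move: ust; rewrite cat_uniq => /and3P[us /hasPn st ut].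
    apply/seteqP; split=> -[a b] /=.
      move=> Bi; split=> j /=; last first.
        case: eqP => // tj; have /= := st _ (mem_tnth j t).
        by rewrite tj mem_tnth.
      by case: eqP => // /(elimT (tuple_uniqP _) us) ->.
    by move=> [/(_ i)/=]; rewrite eqxx.
  exact: coord.
have mf2 : measurable_fun [set: G] (snd : G -> l.-tuple T).
  apply/measurable_fun_tnthP => i _ B mB; rewrite setTI.
  rewrite [X in measurable X](_ : _ =
    (box s (fun y => if y == tnth t i then B else setT) `*`
     box t (fun y => if y == tnth t i then B else setT))); last first.
    move: ust; rewrite cat_uniq => /and3P[us /hasPn st ut].
    apply/seteqP; split=> -[a b] /=.
      move=> Bi; split=> j /=.
        case: eqP => // tj; have /= := st _ (mem_tnth i t).
        by rewrite -tj mem_tnth.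
      by case: eqP => // /(elimT (tuple_uniqP _) ut) ->.
    by move=> [_ /(_ i)/=]; rewrite eqxx.
  exact: coord.
move=> B mB.
(* The identity, written as the pair of its components, is measurable from [G] to the product
   space. *)
have mf : measurable_fun [set: G]
    (fun z : G => (fst z : k.-tuple T, snd z : l.-tuple T)).
  exact: measurable_fun_pair.
have := mf measurableT B mB; rewrite setTI.
by rewrite (_ : _ @^-1` B = B)//; apply/seteqP; split=> -[].
Qed.

End observations.

Section law_of_observations.
Context d dT (Omega : measurableType d) (T : measurableType dT) (R : realType).
Context (Pr : probability Omega R) (P : probability T R).
Context (Z : nat -> {RV Pr >-> T}).
Hypotheses (indep : independent Z) (idist : identically_distributed P Z).

Lemma measurable_obs k (s : k.-tuple nat) :
  measurable_fun [set: Omega] (fun w => obs s (Z ^~ w)).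
Proof.
apply/measurable_fun_tnthP => i.
rewrite (_ : _ \o _ = Z (tnth s i)); first exact: measurable_funPT.
by apply/funext => w /=; rewrite tnth_mktuple.
Qed.

Definition obs_pair k l (s : k.-tuple nat) (t : l.-tuple nat) (w : Omega) :=
  (obs s (Z ^~ w), obs t (Z ^~ w)).

Lemma measurable_obs_pair k l (s : k.-tuple nat) (t : l.-tuple nat) :
  measurable_fun [set: Omega] (obs_pair s t).
Proof. by apply: measurable_fun_pair; exact: measurable_obs. Qed.

HB.instance Definition _ k l (s : k.-tuple nat) (t : l.-tuple nat) :=
  isMeasurableFun.Build _ _ Omega (k.-tuple T * l.-tuple T)%type
    (obs_pair s t) (measurable_obs_pair s t).

(** Boxes form a generating pi-system, and on a box both measures equal the product of the [P (B x)]
    over the labels [x] of [s ++ t]. *)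
Lemma obs_pair_law k l (s : k.-tuple nat) (t : l.-tuple nat)
    (A : set (k.-tuple T * l.-tuple T)) :
  uniq (s ++ t) -> measurable A ->
  distribution Pr (obs_pair s t) A = (product_power P k \x product_power P l)%E A.
Proof.
move=> ust; apply: (measure_unique (boxes s t) (fun=> setT)).
- exact: boxes_generate.
- move=> _ _ [A1 mA1 ->] [A2 mA2 ->]; exists (fun i => A1 i `&` A2 i).
    by move=> i; exact: measurableI.
  apply/seteqP; split=> -[a b] /=.
    by move=> [[a1 b1] [a2 b2]]; split=> i.
  by move=> [ab ba]; split; split=> i; first [by case: (ab i)|by case: (ba i)].
- move=> _; exists (fun=> setT) => //.
  by apply/seteqP; split.
- by apply/seteqP; split=> // x _; exists 0%N.
- move=> _ [B mB ->].
  apply: etrans; last first.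
    by apply/esym/product_measure1E; exact: measurable_box.
  transitivity ((\prod_(x <- s) P (B x)) * (\prod_(x <- t) P (B x)))%E; last first.
    by congr (_ * _)%E; exact/esym/product_power_box.
  rewrite -big_cat /=.
  rewrite /distribution /pushforward.
  (* This is the form of the event in which independence is stated; it is here that indexing boxes
     by labels pays off. *)
  have -> : obs_pair s t @^-1` (box s B `*` box t B) =
      \bigcap_(i in [set` [fset x in s ++ t]%fset]) (Z i @^-1` B i).
    apply/seteqP; split=> w /=.
      move=> [sB tB] x /=; rewrite in_fset /= mem_cat => /orP[] /tnthP[i ->].
        by have := sB i; rewrite tnth_mktuple.
      by have := tB i; rewrite tnth_mktuple.
    move=> h; split=> i; rewrite tnth_mktuple; apply: h => /=.
      by rewrite in_fset mem_cat mem_tnth.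
    by rewrite in_fset mem_cat mem_tnth orbT.
  rewrite indep//.
  rewrite (perm_big (s ++ t)); last first.
    apply: uniq_perm => //; first exact: fset_uniq.
    by move=> x; rewrite in_fset.
  apply: eq_bigr => x _; exact: idist.
- by move=> _; rewrite (le_lt_trans (probability_le1 _ _)) ?ltry.
Qed.

Lemma expect_obs_pair k l (s : k.-tuple nat) (t : l.-tuple nat) F :
  uniq (s ++ t) -> bmf F ->
  \int[Pr]_w F (obs s (Z ^~ w), obs t (Z ^~ w)) =
  \int[product_power P k]_x \int[product_power P l]_y F (x, y).
Proof.
move=> ust bF; rewrite -bmf_fubini// /Rintegral; congr fine.
rewrite -[LHS](integral_distribution (X := obs_pair s t) (f := EFin \o F)).
- by apply: eq_measure_integral => A mA _; exact: obs_pair_law.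
- by apply/measurable_EFinP; case: bF.
- apply: (@bmf_integrable _ _ _ Pr (F \o obs_pair s t)).
  by apply: bmf_comp => //; exact: measurable_obs_pair.
Qed.

(** The case of an empty second tuple, whose factor has mass 1. *)
Lemma obs_law k (s : k.-tuple nat) A : uniq s -> measurable A ->
  Pr [set w | A (obs s (Z ^~ w))] = product_power P k A.
Proof.
move=> us mA.
have := @obs_pair_law k 0 s [tuple] (A `*` setT).
rewrite cats0 => /(_ us (measurableX mA measurableT)).
rewrite product_measure1E// [X in (_ * X)%E](_ : _ = 1%E); last first.
  exact: probability_setT.
rewrite mule1 => <-; rewrite /distribution /pushforward; congr (Pr _).
by apply/seteqP; split=> w //= -[].
Qed.

Lemma expect_obs k (s : k.-tuple nat) F : uniq s -> bmf F ->
  \int[Pr]_w F (obs s (Z ^~ w)) = \int[product_power P k]_x F x.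
Proof.
move=> us bF.
have := @expect_obs_pair k 0 s [tuple] (fun p => F p.1).
rewrite cats0 => /(_ us) /= ->; last exact: bmf_comp.
by apply: eq_Rintegral => x _ /=; rewrite probability_int_cst.
Qed.

Lemma ae_obs k (s : k.-tuple nat) (Q : k.-tuple T -> Prop) : uniq s ->
  {ae product_power P k, forall z, Q z} ->
  {ae Pr, forall w, Q (obs s (Z ^~ w))}.
Proof.
move=> us [N [mN N0 QN]]; exists [set w | N (obs s (Z ^~ w))]; split.
- rewrite -[X in measurable X]setTI; exact: measurable_obs.
- by rewrite obs_law.
- by move=> w /= nQ; apply: QN.
Qed.

(** The converse transfer: it lets almost sure identities on a product power be proved along the
    sample, where arguments can be relabelled. *)
Lemma ae_obsE k (s : k.-tuple nat) (Q : k.-tuple T -> Prop) : uniq s ->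
  measurable [set z | ~ Q z] ->
  {ae Pr, forall w, Q (obs s (Z ^~ w))} ->
  {ae product_power P k, forall z, Q z}.
Proof.
move=> us mQ; case=> N [mN N0 QN].
exists [set z | ~ Q z]; split => //; rewrite -(obs_law us)//.
apply/eqP; rewrite eq_le measure_ge0 andbT -N0 le_measure ?inE//.
rewrite -[X in measurable X]setTI; exact: measurable_obs.
Qed.

End law_of_observations.

Lemma product_power_cons d (T : measurableType d) (R : realType)
    (P : probability T R) k (F : k.+1.-tuple T -> R) : bmf F ->
  \int[product_power P k.+1]_z F z =
  \int[P]_x \int[product_power P k]_z F (tuple_cons (x, z)).
Proof.
move=> bF.
have bFc : bmf (F \o @tuple_cons _ T k).
  by apply: bmf_comp => //; exact: measurable_tuple_cons.
rewrite -(@bmf_fubini _ _ _ _ _ P (product_power P k) _ bFc) /Rintegral.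
congr fine.
rewrite (integral_distribution (X := @tuple_cons _ T k) (f := EFin \o F))//.
- by apply/measurable_EFinP; case: bF.
- exact: (@bmf_integrable _ _ _ (P \x product_power P k)%E _ bFc).
Qed.

(** * Moments of U-statistics *)

Section counting.
Local Open Scope nat_scope.

Lemma leq_card_bigcup (I T : finType) (p : pred I) (A : I -> {set T}) :
  #|\bigcup_(i | p i) A i| <= \sum_(i | p i) #|A i|.
Proof.
elim/big_ind2: _ => [|B1 n1 B2 n2 h1 h2|//]; first by rewrite cards0.
by rewrite (leq_trans (leq_card_setU _ _))// leq_add.
Qed.

Lemma card_tuples_with_values n k (D : {set 'I_k}) (x : 'I_k -> 'I_n) :
  #|[set t : k.-tuple 'I_n | [forall (i | i \in D), tnth t i == x i]]%SET| <=
  n ^ (k - #|D|).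
Proof.
pose F (i : 'I_k) : pred 'I_n :=
  if i \in D then pred1 (x i) else predT.
have -> : n ^ (k - #|D|) = #|family F|.
  rewrite card_family foldrE big_map big_enum /=.
  rewrite (bigID (mem D)) /= [X in (X * _)%N]big1 ?mul1n; last first.
    by move=> i iD; rewrite /F iD card1.
  rewrite (eq_bigr (fun=> n)); last first.
    by move=> i /negbTE iD; rewrite /F iD card_ord.
  rewrite prod_nat_const; congr (_ ^ _).
  have DC := cardC (mem D); rewrite card_ord in DC.
  by apply: (@addnI #|D|); rewrite subnKC// -[leqRHS]DC leq_addr.
have inj : injective (fun t : k.-tuple 'I_n => [ffun i => tnth t i]).
  move=> t u tu; apply: eq_from_tnth => i.
  by have := congr1 (fun f : {ffun _ -> _} => f i) tu; rewrite !ffunE.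
rewrite -(card_imset _ inj); apply: subset_leq_card.
apply/fintype.subsetP => _ /imsetP[t + ->]; rewrite inE => /forallP tD.
apply/familyP => i; rewrite ffunE /F; case: ifP => // iD.
by have := tD i; rewrite iD.
Qed.

(** Union bound: choose the positions [D] of [c] shared entries (at most [2 ^ k] ways) and a map [f]
    telling where each occurs in [s] ([k ^ k] ways); the remaining [k - c] entries are free. *)
Lemma card_tuples_sharing n k c (s : k.-tuple 'I_n) :
  #|[set t : k.-tuple 'I_n | uniq t & c <= count (mem s) t]%SET| <=
  2 ^ k * k ^ k * n ^ (k - c).
Proof.
pose V (D : {set 'I_k}) (f : {ffun 'I_k -> 'I_k}) : {set k.-tuple 'I_n} :=
  [set t : k.-tuple 'I_n |
    [forall (i | i \in D), tnth t i == tnth s (f i)]]%SET.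
apply: (@leq_trans #|\bigcup_(D : {set 'I_k} | #|D| == c)
                      \bigcup_(f : {ffun 'I_k -> 'I_k}) V D f|).
  apply: subset_leq_card; apply/fintype.subsetP => t; rewrite inE => /andP[ut cst].
  pose E : {set 'I_k} := [set i | tnth t i \in s]%SET.
  have cE : c <= #|E|.
    rewrite (leq_trans cst)// -[X in count _ X](map_tnth_enum t) count_map.
    rewrite cardE -size_filter; apply/eq_leq; congr size.
    rewrite enumT; apply: eq_filter => i /=.
    by rewrite !inE.
  (* There may be more than [c] shared positions; keeping the first [c] gives [D] the exact
     cardinality. *)
  pose D : {set 'I_k} := [set x in take c (enum E)]%SET.
  have uD : uniq (take c (enum E)) by rewrite take_uniq// enum_uniq.
  have cD : #|D| == c.
    by rewrite cardsE (card_uniqP uD) size_takel -?cardE.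
  (* The default [i] is not reached on [D], where the entry of [t] does occur in [s]. *)
  pose f := [ffun i => odflt i [pick j | tnth s j == tnth t i]].
  apply/bigcupP; exists D => //; apply/bigcupP; exists f => //.
  rewrite inE; apply/forallP => i; apply/implyP; rewrite inE => iD.
  have : i \in E by rewrite -mem_enum (mem_take iD).
  rewrite inE => /tnthP[j tj]; rewrite ffunE; case: pickP => [j'|/(_ j)].
    by move=> /eqP /= ->.
  by rewrite tj eqxx.
apply: leq_trans (leq_card_bigcup _ _) _.
apply: (@leq_trans (\sum_(D : {set 'I_k} | #|D| == c) k ^ k * n ^ (k - c))).
  apply: leq_sum => D /eqP Dc; apply: leq_trans (leq_card_bigcup _ _) _.
  apply: (@leq_trans (\sum_(f : {ffun 'I_k -> 'I_k}) n ^ (k - c))).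
    apply: leq_sum => f _; rewrite -Dc.
    exact: (card_tuples_with_values D (fun i => tnth s (f i))).
  by rewrite sum_nat_const card_ffun !card_ord.
rewrite sum_nat_const -mulnA leq_mul2r; apply/orP; right.
apply: leq_trans (max_card _) _.
by rewrite -cardsT -powersetT card_powerset cardsT card_ord.
Qed.

Definition num_uniq n k := #|[pred s : k.-tuple 'I_n | uniq s]|.

Lemma num_uniqE n k : num_uniq n k = n ^_ k.
Proof.
rewrite -[in RHS](card_ord n) -(card_uniq_tuples k predT) cardsE.
by apply: eq_card => t; rewrite !inE unfold_in /= all_predT.
Qed.

(** Each factor [n - i] with [i < k] is at least half of [n]. *)
Lemma leq_expn_ffact n k : 2 * k <= n -> n ^ k <= 2 ^ k * n ^_ k.
Proof.
move=> kn; rewrite ffact_prod -[X in n ^ X]card_ord -[X in 2 ^ X]card_ord.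
rewrite -!prod_nat_const -big_split /=; apply: leq_prod => i _.
have := ltn_ord i; lia.
Qed.

Lemma card_sharing_pairs n k c (s : k.-tuple 'I_n) : 2 * k <= n ->
  n ^ c * #|[set t : k.-tuple 'I_n | uniq t & c <= count (mem s) t]%SET| <=
  4 ^ k * k ^ k * num_uniq n k.
Proof.
(* For [c > k] the exponent [k - c] is truncated to 0, but then no tuple can share [c] entries. *)
move=> kn; have [ck|kc] := leqP c k; last first.
  rewrite (_ : #|_| = 0) ?muln0//; apply/eqP; rewrite cards_eq0.
  apply/eqP/setP => t; rewrite !inE; apply/negbTE/negP => /andP[_].
  move=> /(leq_trans kc); rewrite ltnNge.
  by rewrite (leq_trans (count_size _ _))// size_tuple.
apply: (@leq_trans (n ^ c * (2 ^ k * k ^ k * n ^ (k - c)))).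
  by rewrite leq_mul2l card_tuples_sharing orbT.
rewrite mulnCA -expnD subnKC// (_ : 4 = 2 * 2)// expnMn -!mulnA num_uniqE.
rewrite leq_mul2l; apply/orP; right.
by rewrite [leqRHS]mulnCA leq_mul2l leq_expn_ffact ?orbT.
Qed.

End counting.

(** * Algebra of U-statistics *)

Section U_statistic_algebra.
Context d (T : measurableType d) (R : realType).

Definition labels n k (s : k.-tuple 'I_n) : k.-tuple nat :=
  map_tuple val s.

Lemma uniq_labels n k (s : k.-tuple 'I_n) : uniq (labels s) = uniq s.
Proof. by rewrite map_inj_uniq//; exact: val_inj. Qed.

Lemma count_labels n k (s t : k.-tuple 'I_n) :
  count (mem (labels s)) (labels t) = count (mem s) t.
Proof.
rewrite count_map; apply: eq_count => i /=.
by rewrite mem_map//; exact: val_inj.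
Qed.

Lemma U_statE k (psi : k.-tuple T -> R) n z : U_stat psi n z =
  (\sum_(s : k.-tuple 'I_n | uniq s) psi (obs (labels s) z)) /
    (num_uniq n k)%:R.
Proof.
congr (_ / _); apply: eq_bigr => s _; congr psi.
by apply: eq_from_tnth => i; rewrite !tnth_mktuple tnth_map.
Qed.

Lemma num_uniq_gt0 n k : (k <= n)%N -> 0 < (num_uniq n k)%:R :> R.
Proof. by move=> kn; rewrite ltr0n num_uniqE ffact_gt0. Qed.

Lemma U_statB k (f h : k.-tuple T -> R) n z :
  U_stat (fun x => f x - h x) n z = U_stat f n z - U_stat h n z.
Proof. by rewrite !U_statE sumrB mulrBl. Qed.

Lemma sum_uniq_cst n k (c : R) :
  \sum_(s : k.-tuple 'I_n | uniq s) c = (num_uniq n k)%:R * c.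
Proof. by rewrite sumr_const mulr_natl. Qed.

Lemma U_stat_cst k (c : R) n z : (k <= n)%N ->
  U_stat (fun _ : k.-tuple T => c) n z = c.
Proof.
move=> kn; rewrite U_statE sum_uniq_cst mulrAC divff ?mul1r//.
by rewrite gt_eqF// num_uniq_gt0.
Qed.

(* Every observation occupies a given position in the same number of tuples,
   because a transposition of the indices permutes the tuples. *)
Lemma card_uniq_tuples_through n k (i : 'I_k) (j : 'I_n) :
  (n * #|[set s : k.-tuple 'I_n | uniq s & tnth s i == j]%SET| =
   num_uniq n k)%N.
Proof.
pose Q j : {set k.-tuple 'I_n} := 
  [set s : k.-tuple 'I_n | uniq s & tnth s i == j]%SET.
have QQ j1 j2 : (#|Q j1| <= #|Q j2|)%N.
  pose f (s : k.-tuple 'I_n) : k.-tuple 'I_n := map_tuple (tperm j1 j2) s.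
  have inj : injective f.
    move=> s t /(congr1 val) /= /inj_map st.
    by apply: val_inj; apply: st; exact: perm_inj.
  rewrite -(card_imset _ inj); apply: subset_leq_card.
  apply/fintype.subsetP => _ /imsetP[s + ->]; rewrite !inE.
  move=> /andP[us /eqP si]; rewrite tnth_map si tpermL eqxx andbT.
  by rewrite map_inj_uniq//; exact: perm_inj.
have QE j' : #|Q j'| = #|Q j| by apply/eqP; rewrite eqn_leq !QQ.
rewrite -/(Q j) /num_uniq -[RHS]sum1_card.
rewrite [RHS](partition_big (fun s => tnth s i) xpredT)//=.
rewrite [RHS](eq_bigr (fun=> #|Q j|)); last first.
  by move=> j' _; rewrite -(QE j') -sum1_card; apply: eq_bigl => s; rewrite !inE.
by rewrite sum_nat_const card_ord.
Qed.

(** After exchanging the sums, each of the [k] positions contributes the sample mean of [f], because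
    every observation occupies it in a share [1 / n] of the tuples. *)
Lemma U_stat_linear k (f : T -> R) n z : (k <= n)%N -> (0 < n)%N ->
  U_stat (fun x : k.-tuple T => \sum_(i < k) f (tnth x i)) n z =
  k%:R / n%:R * \sum_(j < n) f (z j).
Proof.
move=> kn n0; rewrite U_statE.
have N0 := num_uniq_gt0 kn.
under eq_bigr do under eq_bigr do rewrite tnth_mktuple tnth_map.
rewrite exchange_big /= (eq_bigr (fun=>
  (num_uniq n k)%:R / n%:R * \sum_(j < n) f (z j))); last first.
  move=> i _; rewrite (partition_big (fun s => tnth s i) xpredT)//= mulr_sumr.
  apply: eq_bigr => j _.
  rewrite (eq_bigr (fun=> f (z j))); last by move=> s /andP[_ /eqP ->].
  rewrite sumr_const -[LHS]mulr_natl -(card_uniq_tuples_through i j) natrM.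
  rewrite [n%:R * _]mulrC mulfK ?pnatr_eq0 -?lt0n//.
  by congr (_%:R * _); apply: eq_card => s; rewrite !inE.
rewrite sumr_const card_ord -mulr_natr.
have nz : n%:R != 0 :> R by rewrite pnatr_eq0 -lt0n.
have Nz : (num_uniq n k)%:R != 0 :> R by rewrite gt_eqF.
by field; rewrite nz Nz.
Qed.

End U_statistic_algebra.

(** * Second moments of U-statistics *)

Section U_statistic_moments.
Context d dT (Omega : measurableType d) (T : measurableType dT) (R : realType).
Context (Pr : probability Omega R) (P : probability T R).
Context (Z : nat -> {RV Pr >-> T}).

Lemma measurable_U_stat k (psi : k.-tuple T -> R) n :
  measurable_fun [set: _] psi ->
  measurable_fun [set: Omega] (fun w => U_stat psi n (Z ^~ w)).
Proof.
move=> mpsi; under eq_fun do rewrite U_statE -big_filter.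
apply: measurable_funM => //; apply: measurable_sum => s.
by apply: measurableT_comp => //; exact: measurable_obs.
Qed.

Lemma bmf_obs k (psi : k.-tuple T -> R) s : bmf psi ->
  bmf (fun w => psi (obs s (Z ^~ w))).
Proof. by move=> bpsi; apply: bmf_comp bpsi; exact: measurable_obs. Qed.

Lemma bmf_U_stat k (psi : k.-tuple T -> R) n : bmf psi ->
  bmf (fun w => U_stat psi n (Z ^~ w)).
Proof.
move=> bpsi; under eq_fun do rewrite U_statE.
apply: bmfM; last exact: bmf_cst.
by apply: bmf_sum => s _; exact: bmf_obs.
Qed.

(** Expanding the square gives an average over pairs of tuples. Only pairs sharing at least [c]
    labels contribute, each at most [B ^+ 2], and they are a fraction O(n^-c) of all pairs. The case
    [c = 1] yields laws of large numbers, [c = 2] the bound on the Hoeffding remainder. *)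
Lemma U_stat_second_moment k (psi : k.-tuple T -> R) c (B : R) :
  bmf psi -> (forall x, `|psi x| <= B) ->
  (forall s t : k.-tuple nat, uniq s -> uniq t -> (count (mem s) t < c)%N ->
    \int[Pr]_w (psi (obs s (Z ^~ w)) * psi (obs t (Z ^~ w))) = 0) ->
  forall n, (2 * k <= n)%N ->
  n%:R ^+ c * \int[Pr]_w (U_stat psi n (Z ^~ w) ^+ 2) <=
  (4 ^ k * k ^ k)%:R * B ^+ 2.
Proof.
move=> bpsi psiB psi0 n kn; have N0 := @num_uniq_gt0 R n k ltac:(lia).
pose I (s t : k.-tuple 'I_n) :=
  \int[Pr]_w (psi (obs (labels s) (Z ^~ w)) * psi (obs (labels t) (Z ^~ w))).
set N := (num_uniq n k)%:R in N0 *.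
have bst (s t : k.-tuple 'I_n) :
    bmf (fun w => psi (obs (labels s) (Z ^~ w)) * psi (obs (labels t) (Z ^~ w))).
  by apply: bmfM; exact: bmf_obs.
have -> : \int[Pr]_w (U_stat psi n (Z ^~ w) ^+ 2) =
    N ^- 2 * \sum_(s : k.-tuple 'I_n | uniq s)
      \sum_(t : k.-tuple 'I_n | uniq t) I s t.
  rewrite -(eq_bigr _ (fun s _ => bmf_int_sum Pr _ (fun t _ => bst s t))).
  rewrite -bmf_int_sum; last by move=> s _; apply: bmf_sum => t _.
  rewrite -bmf_intZ; last by apply: bmf_sum => s _; apply: bmf_sum => t _.
  apply: eq_Rintegral => w _; rewrite U_statE exprMn exprVn mulrC; congr (_ * _).
  by rewrite expr2 mulr_suml; apply: eq_bigr => s _; rewrite mulr_sumr.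
have B0 : 0 <= B ^+ 2 by rewrite sqr_ge0.
have Ile s t : I s t <= B ^+ 2.
  apply: le_trans (ler_norm _) _; apply: bmf_norm_int_le; first exact: bst.
  by move=> w; rewrite normrM expr2 ler_pM.
(* The count of sharing tuples is uniform in [s], so the double sum can be bounded row by row. *)
have row (s : k.-tuple 'I_n) : uniq s ->
    n%:R ^+ c * \sum_(t : k.-tuple 'I_n | uniq t) I s t <=
    (4 ^ k * k ^ k)%:R * N * B ^+ 2.
  move=> us; rewrite -natrM.
  apply: (@le_trans _ _ ((n ^ c * #|[set t : k.-tuple 'I_n |
      uniq t & (c <= count (mem s) t)%N]%SET|)%:R * B ^+ 2)); last first.
    by rewrite ler_wpM2r// ler_nat; exact: card_sharing_pairs.
  rewrite natrM natrX -mulrA ler_wpM2l ?exprn_ge0//.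
  rewrite -sumr_const mulr_suml.
  rewrite (bigID (fun t : k.-tuple 'I_n => (c <= count (mem s) t)%N)) /=.
  rewrite [X in _ + X]big1 ?addr0; last first.
    move=> t /andP[ut]; rewrite -ltnNge => cst; apply: psi0.
    - by rewrite uniq_labels.
    - by rewrite uniq_labels.
    - by rewrite count_labels.
  rewrite [leRHS](eq_bigl (fun t : k.-tuple 'I_n =>
    uniq t && (c <= count (mem s) t)%N)); last by move=> t; rewrite inE.
  by apply: ler_sum => t _; rewrite mul1r.
rewrite mulrCA ler_pdivrMl ?exprn_gt0// mulr_sumr.
apply: (@le_trans _ _ (\sum_(s : k.-tuple 'I_n | uniq s)
  (4 ^ k * k ^ k)%:R * N * B ^+ 2)); first exact: ler_sum.
rewrite sum_uniq_cst -/N.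
by rewrite le_eqVlt; apply/orP; left; apply/eqP; ring.
Qed.

End U_statistic_moments.

(** * Hoeffding projection *)

Lemma product_power_marginal d (T : measurableType d) (R : realType)
    (P : probability T R) k (f : T -> R) (i : 'I_k) : bmf f ->
  \int[product_power P k]_z f (tnth z i) = \int[P]_x f x.
Proof.
move=> bf; elim: k i => [[]//|k IH] i.
rewrite product_power_cons; last first.
  by apply: (@bmf_comp _ _ _ _ _ (fun z => tnth z i)) => //; exact: measurable_tnth.
case: (unliftP ord0 i) => [j ->|->].
  under eq_Rintegral do under eq_Rintegral do rewrite tnthS.
  under eq_Rintegral do rewrite IH.
  by rewrite probability_int_cst.
under eq_Rintegral do under eq_Rintegral do rewrite tnth0 /=.
by under eq_Rintegral do rewrite probability_int_cst.
Qed.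

Section projection.
Context d dT (Omega : measurableType d) (T : measurableType dT) (R : realType).
Context (Pr : probability Omega R) (P : probability T R).
Context (Z : nat -> {RV Pr >-> T}).
Hypotheses (indep : independent Z) (idist : identically_distributed P Z).
Context (g : nat).
Implicit Types psi phi : g.+1.-tuple T -> R.

Definition symmetric_kernel k (phi : k.-tuple T -> R) :=
  forall z z' : k.-tuple T, perm_eq z z' -> phi z = phi z'.

(** For a symmetric kernel this is the conditional expectation given any one argument. *)
Definition first_projection phi (x : T) : R :=
  \int[product_power P g]_r phi (tuple_cons (x, r)).

Lemma bmf_cons phi : bmf phi -> bmf (phi \o @tuple_cons _ T g).
Proof. by move=> bphi; apply: bmf_comp bphi; exact: measurable_tuple_cons. Qed.

Lemma bmf_first_projection phi : bmf phi -> bmf (first_projection phi).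
Proof.
by move=> bphi; exact: (@bmf_fubini_F _ _ _ _ _ P _ _ (bmf_cons bphi)).
Qed.

Lemma int_first_projection phi : bmf phi ->
  \int[P]_x first_projection phi x = \int[product_power P g.+1]_z phi z.
Proof. by move=> bphi; rewrite product_power_cons. Qed.

Lemma bmf_share phi (j : 'I_g.+1) : bmf phi ->
  bmf (fun p : g.+1.-tuple T * g.-tuple T =>
    phi p.1 * phi (tuple_cons (tnth p.1 j, p.2))).
Proof.
move=> bphi; apply: bmfM; first exact: bmf_comp bphi.
apply: (@bmf_comp _ _ _ _ _ (fun p => tuple_cons (tnth p.1 j, p.2)) phi) => //.
apply: (measurable_cons (f := fun p => tnth p.1 j) (g := snd)) => //.
apply: (@measurableT_comp _ _ _ _ _ _ (fun z => tnth z j) _ fst) => //.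
exact: measurable_tnth.
Qed.

Lemma expect_disjoint k (phi psi : k.-tuple T -> R) (s t : k.-tuple nat) :
  bmf phi -> bmf psi -> uniq (s ++ t) ->
  \int[Pr]_w (phi (obs s (Z ^~ w)) * psi (obs t (Z ^~ w))) =
  (\int[product_power P k]_z phi z) * \int[product_power P k]_z psi z.
Proof.
move=> bphi bpsi ust.
have bF : bmf (fun p : k.-tuple T * k.-tuple T => phi p.1 * psi p.2).
  by apply: bmfM; [exact: bmf_comp bphi|exact: bmf_comp bpsi].
rewrite (expect_obs_pair indep idist ust bF) /=.
under eq_Rintegral do rewrite bmf_intZ//.
under eq_Rintegral do rewrite mulrC.
by rewrite bmf_intZ// mulrC.
Qed.

(** The product depends on the disjoint tuples [s] and [t] only. Integrating over [t] first turns
    the second factor into the projection at the shared observation. *)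
Lemma expect_share phi (j : 'I_g.+1) (s : g.+1.-tuple nat) (t : g.-tuple nat) :
  bmf phi -> uniq (s ++ t) ->
  \int[Pr]_w (phi (obs s (Z ^~ w)) *
              phi (obs [tuple of tnth s j :: t] (Z ^~ w))) =
  \int[product_power P g.+1]_z (phi z * first_projection phi (tnth z j)).
Proof.
move=> bphi ust.
have := expect_obs_pair indep idist ust (bmf_share j bphi).
rewrite /= => E; under eq_Rintegral do rewrite obs_cons.
under eq_Rintegral do rewrite -(tnth_mktuple (fun i => Z (tnth s i) _) j).
rewrite E; apply: eq_Rintegral => z _; rewrite bmf_intZ//.
exact: (bmf_section (bmf_cons bphi)).
Qed.

(** Without a common label the expectation factors into means, which vanish because the projection
    does. With one common label, symmetry brings it to the front of [t], and integrating over the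
    other labels of [t] produces the vanishing projection. *)
Lemma degenerate_covariance psi (s t : g.+1.-tuple nat) :
  bmf psi -> symmetric_kernel psi -> (forall x, first_projection psi x = 0) ->
  uniq s -> uniq t -> (count (mem s) t < 2)%N ->
  \int[Pr]_w (psi (obs s (Z ^~ w)) * psi (obs t (Z ^~ w))) = 0.
Proof.
move=> bpsi sym psi0 us ut st2.
have [/hasP[a at_ /= as_]|dis] := boolP (has (mem s) t); last first.
  rewrite expect_disjoint//; last by rewrite cat_uniq us dis.
  rewrite -[X in X * _]int_first_projection//.
  under eq_Rintegral do rewrite psi0.
  by rewrite probability_int_cst mul0r.
have sz : size (rem a t) == g by rewrite size_rem// size_tuple.
pose t' := Tuple sz.
have tt' : perm_eq t (a :: t') by exact: perm_to_rem.
have [j aj] : exists j, a = tnth s j by apply/tnthP.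
(* Fewer than two labels are shared, so removing [a] leaves a tuple disjoint from [s]. *)
have ust' : uniq (s ++ t').
  rewrite cat_uniq us /= (rem_uniq _ ut) andbT.
  move/seq.permP : tt' => /(_ (mem s)) /= E; rewrite E as_ add1n ltnS in st2.
  by rewrite has_count -leqNgt -ltnS.
have E (w : Omega) : psi (obs t (Z ^~ w)) =
    psi (obs [tuple of tnth s j :: t'] (Z ^~ w)).
  by apply: sym; rewrite !val_obs perm_map// -aj.
under eq_Rintegral do rewrite E.
rewrite (expect_share _ bpsi ust').
under eq_Rintegral do rewrite psi0 mulr0.
by rewrite probability_int_cst.
Qed.

(** Given the common observation the two factors are independent with the same conditional mean.
    This identifies [kappa 1] below. *)
Lemma expect_share_one phi a (s t : g.-tuple nat) : bmf phi ->
  uniq (a :: s ++ t) ->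
  \int[Pr]_w (phi (obs [tuple of a :: s] (Z ^~ w)) *
              phi (obs [tuple of a :: t] (Z ^~ w))) =
  \int[P]_x (first_projection phi x ^+ 2).
Proof.
move=> bphi ust.
have := @expect_share phi ord0 [tuple of a :: s] t bphi ust.
rewrite tnth0 => ->; rewrite product_power_cons; last first.
  apply: bmfM => //; apply: (@bmf_comp _ _ _ _ _ (fun z => tnth z ord0)).
    exact: measurable_tnth.
  exact: bmf_first_projection.
apply: eq_Rintegral => x _.
under eq_Rintegral do rewrite tnth0 mulrC /=.
by rewrite bmf_intZ//; exact: (bmf_section (bmf_cons bphi)).
Qed.

Section hajek.
Variable phi : g.+1.-tuple T -> R.
Hypotheses (bphi : bmf phi) (sphi : symmetric_kernel phi).
Let m := g.+1.
Let D := \int[product_power P m]_z phi z.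

Definition centered_projection (x : T) : R := first_projection phi x - D.

Lemma bmf_centered_projection : bmf centered_projection.
Proof. by apply: bmfB; [exact: bmf_first_projection|exact: bmf_cst]. Qed.

Lemma int_centered_projection : \int[P]_x centered_projection x = 0.
Proof.
rewrite bmf_intB; [|exact: bmf_first_projection|exact: bmf_cst].
by rewrite int_first_projection// probability_int_cst subrr.
Qed.

Lemma int_centered_projection_sqr :
  \int[P]_x (centered_projection x ^+ 2) =
  \int[P]_x (first_projection phi x ^+ 2) - D ^+ 2.
Proof.
have bh := bmf_first_projection bphi.
transitivity (\int[P]_x (first_projection phi x ^+ 2 -
    (2 * D * first_projection phi x - D ^+ 2))).
  by apply: eq_Rintegral => x _; rewrite /centered_projection; ring.
have b1 : bmf (fun x => first_projection phi x ^+ 2) by exact: bmfM.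
have b2 : bmf (fun x => 2 * D * first_projection phi x).
  by apply: bmfM => //; exact: bmf_cst.
have b3 : bmf (fun _ : T => D ^+ 2) by exact: bmf_cst.
rewrite bmf_intB//; last exact: bmfB.
rewrite bmf_intB// bmf_intZ// int_first_projection// probability_int_cst -/m -/D.
by ring.
Qed.

Definition remainder (z : m.-tuple T) : R :=
  phi z - D - \sum_(i < m) centered_projection (tnth z i).

Lemma bmf_tnth k (f : T -> R) (i : 'I_k) : bmf f ->
  bmf (fun z : k.-tuple T => f (tnth z i)).
Proof.
move=> bf; apply: (@bmf_comp _ _ _ _ _ (fun z => tnth z i)) => //.
exact: measurable_tnth.
Qed.

Lemma bmf_remainder : bmf remainder.
Proof.
apply: bmfB; first by apply: bmfB => //; exact: bmf_cst.
apply: bmf_sum => i _; apply: bmf_tnth; exact: bmf_centered_projection.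
Qed.

Lemma symmetric_remainder : symmetric_kernel remainder.
Proof.
move=> z z' zz'; rewrite /remainder (sphi zz'); congr (_ - _).
rewrite -(big_tuple _ _ z xpredT centered_projection).
by rewrite -(big_tuple _ _ z' xpredT centered_projection); exact: perm_big.
Qed.

(** Given the first argument, the centered kernel integrates to [centered_projection x], which its
    own term cancels; the terms of the other arguments have mean zero. *)
Lemma first_projection_remainder x : first_projection remainder x = 0.
Proof.
have bc := bmf_centered_projection.
rewrite /first_projection /remainder.
have b0 := bmf_section (bmf_cons bphi) x.
transitivity (\int[product_power P g]_r ((phi (tuple_cons (x, r)) - D) -
    (centered_projection x + \sum_(i < g) centered_projection (tnth r i)))).
  apply: eq_Rintegral => r _; rewrite big_ord_recl tnth0.
  by under eq_bigr do rewrite tnthS.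
have b1 : bmf (fun r : g.-tuple T => \sum_(i < g) centered_projection (tnth r i)).
  by apply: bmf_sum => i _; exact: bmf_tnth.
have bcst c : bmf (fun _ : g.-tuple T => c) by exact: bmf_cst.
rewrite bmf_intB; [|exact: bmfB|exact: bmfD].
rewrite bmf_intB// bmf_intD// !probability_int_cst bmf_int_sum//; last first.
  by move=> i _; exact: bmf_tnth.
rewrite big1 ?addr0 ?subrr//.
by move=> i _; rewrite product_power_marginal// int_centered_projection.
Qed.

Lemma U_stat_remainder n z : (m <= n)%N ->
  U_stat remainder n z = U_stat phi n z - D -
    m%:R / n%:R * \sum_(j < n) centered_projection (z j).
Proof.
move=> mn; rewrite /remainder U_statB U_statB U_stat_cst// U_stat_linear//.
by apply: leq_trans mn.
Qed.

Lemma hajek_projection : exists K : R, forall n, (2 * m <= n)%N ->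
  n%:R ^+ 2 * \int[Pr]_w ((U_stat phi n (Z ^~ w) - D -
    m%:R / n%:R * \sum_(j < n) centered_projection (Z j w)) ^+ 2) <= K.
Proof.
have [B _ rB] := bmf_ub bmf_remainder.
exists ((4 ^ m * m ^ m)%:R * B ^+ 2) => n mn.
under eq_Rintegral do rewrite -(U_stat_remainder _ (ltac:(lia) : (m <= n)%N)).
apply: U_stat_second_moment => //; first exact: bmf_remainder.
move=> s t us ut st; apply: degenerate_covariance => //.
- exact: bmf_remainder.
- exact: symmetric_remainder.
- exact: first_projection_remainder.
Qed.

End hajek.

(** After centering, disjoint tuples give uncorrelated values, so the second moment bound applies
    with [c = 1]. No symmetry of the kernel enters. *)
Lemma U_stat_law_of_large_numbers k (psi : k.-tuple T -> R) : bmf psi ->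
  exists K : R, forall n, (2 * k <= n)%N ->
  n%:R * \int[Pr]_w ((U_stat psi n (Z ^~ w) -
    \int[product_power P k]_z psi z) ^+ 2) <= K.
Proof.
move=> bpsi; set th := \int[_]_z _.
have b1 : bmf (fun z => psi z - th) by apply: bmfB => //; exact: bmf_cst.
have [B _ rB] := bmf_ub b1.
exists ((4 ^ k * k ^ k)%:R * B ^+ 2) => n kn.
have E z : U_stat psi n z - th = U_stat (fun z => psi z - th) n z.
  by rewrite U_statB U_stat_cst//; lia.
under eq_Rintegral do rewrite E.
rewrite -[n%:R]expr1.
apply: U_stat_second_moment => // s t us ut; rewrite ltnS leqn0 => /eqP st.
rewrite (expect_disjoint b1 b1); last by rewrite cat_uniq us ut has_count st.
rewrite bmf_intB//; last exact: bmf_cst.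
by rewrite probability_int_cst subrr mul0r.
Qed.

End projection.

(** * The normal distribution function and the Lindeberg argument *)

Section mean_value.
Context (R : realType).
Implicit Types f : R -> R.

Definition has_derivative f (f' : R -> R) :=
  forall x : R, is_derive x 1 f (f' x).

Lemma has_derivative_continuous f f' : has_derivative f f' -> continuous f.
Proof.
move=> df x; apply/differentiable_continuous/derivable1_diffP.
by have [] := df x.
Qed.

(** Stated for either order of [a] and [b], since the increments in the Taylor expansions have
    arbitrary sign. *)
Lemma mean_value f f' (a b : R) : has_derivative f f' ->
  exists c, [/\ Num.min a b <= c, c <= Num.max a b,
    `|c - a| <= `|b - a| & f b - f a = f' c * (b - a)].
Proof.
move=> df; have cw u v : {within `[u, v], continuous f}.
  exact/continuous_subspaceT/(has_derivative_continuous df).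
have [ab|/ltW ba] := leP a b.
  have [c + fc] := MVT_segment ab (fun x _ => df x) (@cw a b).
  rewrite in_itv /= => /andP[ac cb]; exists c; split => //.
  by rewrite !ger0_norm ?subr_ge0// lerB.
have [c + fc] := MVT_segment ba (fun x _ => df x) (@cw b a).
rewrite in_itv /= => /andP[bc ca]; exists c; split => //.
  by rewrite !ler0_norm ?subr_le0// lerN2 lerB.
by rewrite -opprB fc -mulrN opprB.
Qed.

Lemma taylor1 f f' f'' (M a b : R) :
  has_derivative f f' -> has_derivative f' f'' ->
  (forall c, Num.min a b <= c <= Num.max a b -> `|f'' c| <= M) ->
  `|f b - f a - f' a * (b - a)| <= M * (b - a) ^+ 2.
Proof.
move=> df df' fM; have [c [ac cb cab ->]] := mean_value a b df.
rewrite -mulrBl normrM -[_ ^+ 2]real_normK ?num_real// expr2 mulrA.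
apply: ler_wpM2r => //; have [e [ae ec _ ->]] := mean_value a c df'.
have M0 : 0 <= M by apply: le_trans (fM c _); rewrite ?ac.
rewrite normrM ler_pM// fM//.
(* The point [e] lies between [a] and [c], hence between [a] and [b]. *)
by move: ac cb ae ec; rewrite !minElt !maxElt; do !case: ifP; lra.
Qed.

Lemma taylor2 f f' f'' f''' (M a b : R) :
  has_derivative f f' -> has_derivative f' f'' -> has_derivative f'' f''' ->
  (forall x, `|f''' x| <= M) ->
  `|f b - f a - f' a * (b - a) - f'' a / 2 * (b - a) ^+ 2| <=
    M * `|b - a| ^+ 3.
Proof.
move=> df df' df'' fM.
(* The derivative of [G] is the first-order Taylor remainder of [f'] at [a], to which [taylor1]
   applies. *)
pose G x := f x - f' a * x - f'' a / 2 * (x - a) ^+ 2.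
have dG : has_derivative G (fun x => f' x - f' a - f'' a * (x - a)).
  move=> x; have dx := is_derive_id x (1 : R).
  have d1 : is_derive x 1 (fun y => f' a * y) (f' a * 1).
    exact: (@is_deriveZ _ _ _ (id : R -> R) (f' a) x 1 1).
  have d2 : is_derive x (1 : R) (fun y => y - a) (1 - 0).
    exact: (@is_deriveB _ _ _ (id : R -> R) (cst a)).
  have d3 := @is_deriveX _ _ _ 2 _ _ _ d2.
  have d4 := @is_deriveZ _ _ _ _ (f'' a / 2) x 1 _ d3.
  have d5 : is_derive x (1 : R) G _ := is_deriveB (is_deriveB (df x) d1) d4.
  apply: (is_derive_eq d5); rewrite /GRing.scale /=.
  by rewrite !mulr1 subr0 expr1; field.
have [c [ac cb cab Gc]] := mean_value a b dG.
have -> : f b - f a - f' a * (b - a) - f'' a / 2 * (b - a) ^+ 2 = G b - G a.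
  by rewrite /G; ring.
rewrite Gc normrM exprSr mulrA ler_wpM2r//.
apply: le_trans (taylor1 df' df'' (fun x _ => fM x)) _.
rewrite -[_ ^+ 2]real_normK ?num_real//.
have M0 : 0 <= M by apply: le_trans (fM 0).
by rewrite ler_wpM2l// ler_pXn2r// ?nnegrE.
Qed.

End mean_value.

(** * The standard normal density and distribution function *)

Section gaussian.
Context (R : realType).

Definition npdf : R -> R := normal_pdf 0 1.

Definition ncdf (x : R) : R :=
  \int[lebesgue_measure]_(t in `]-oo, x]) npdf t.

Lemma npdfE x : npdf x = normal_peak 1 * expR (- (x ^+ 2 / 2)).
Proof.
rewrite /npdf normal_pdfE ?oner_eq0// /normal_fun subr0 expr1n mulNr.
by [].
Qed.

Lemma ncdfE x : normal_prob 0 1 `]-oo, x] = (ncdf x)%:E.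
Proof.
rewrite -[LHS]fineK//.
by rewrite fin_num_measure.
Qed.

Lemma ncdf_ge0 x : 0 <= ncdf x.
Proof. by rewrite -lee_fin -ncdfE. Qed.

Lemma ncdf_le1 x : ncdf x <= 1.
Proof. by rewrite -lee_fin -ncdfE probability_le1. Qed.

Lemma ncdf_le x y : x <= y -> ncdf x <= ncdf y.
Proof.
move=> xy; rewrite -lee_fin -!ncdfE le_measure ?inE//.
by move=> t /=; rewrite !in_itv/= => /le_trans; exact.
Qed.

(** Under the standard normal law the identity has distribution function [ncdf], so the limits of
    distribution functions at infinity become available. *)
Let idRV : measurableTypeR R -> R := idfun.

#[local] HB.instance Definition _ :=
  @isMeasurableFun.Build _ _ _ _ idRV (@measurable_id _ _ setT).

Let idRV_cdf x : cdf (idRV : {RV normal_prob 0 1 >-> R}) x = (ncdf x)%:E.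
Proof. by rewrite -ncdfE. Qed.

Lemma ncdf_cvgy : ncdf x @[x --> +oo] --> (1 : R).
Proof.
have /fine_cvg := cvg_cdfy1 (idRV : {RV normal_prob 0 1 >-> R}).
by congr (_ --> _); congr fmap; apply/funext => x /=; rewrite -ncdfE.
Qed.

Lemma ncdf_cvgNy : ncdf x @[x --> -oo] --> (0 : R).
Proof.
have /fine_cvg := cvg_cdfNy0 (idRV : {RV normal_prob 0 1 >-> R}).
by congr (_ --> _); congr fmap; apply/funext => x /=; rewrite -ncdfE.
Qed.

Lemma has_derivative_ncdf : has_derivative ncdf npdf.
Proof.
move=> x.
have cx : {for x, continuous npdf}.
  by apply: continuous_normal_pdf; rewrite oner_eq0.
(* Any end point to the right of [x] would do for [x + 1]. *)
have [] := @continuous_FTC1 R npdf -oo%O x (x + 1) _ _ _ cx.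
- by rewrite ltrDl.
- apply: integrableS (integrable_normal_pdf 0 1) => //.
- by rewrite ltNyr.
move=> dx Dx; apply: DeriveDef => //.
by rewrite -derive1E.
Qed.

Lemma continuous_ncdf : continuous ncdf.
Proof. exact: has_derivative_continuous has_derivative_ncdf. Qed.

Lemma measurable_ncdf : measurable_fun [set: R] ncdf.
Proof. by apply: continuous_measurable_fun; exact: continuous_ncdf. Qed.

Lemma has_derivative_npdf : has_derivative npdf (fun x => - (x * npdf x)).
Proof.
move=> x.
have d1 : is_derive x (1 : R) (fun y => (- 2^-1) * y ^+ 2) (- x).
  have d0 : is_derive x (1 : R) (fun y => y ^+ 2) ((2%:R * x ^+ 1) *: (1 : R)).
    exact: (@is_deriveX _ _ (id : R -> R) 2 x 1 1 (is_derive_id _ _)).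
  have h := @is_deriveZ _ _ _ _ (- 2^-1) x 1 _ d0.
  by apply: (is_derive_eq h); rewrite /GRing.scale /=; field.
have d2 := @is_derive1_comp _ _ _ x _ _ (is_derive_expR _) d1.
have d3 := @is_deriveZ _ _ _ _ (normal_peak 1) x 1 _ d2.
have u2 (y : R) : - 2^-1 * y ^+ 2 = - (y ^+ 2 / 2) by field.
have E : (fun y => normal_peak 1 * expR (- 2^-1 * y ^+ 2)) = npdf.
  by apply/funext => y; rewrite npdfE -u2.
have d4 : is_derive x (1 : R)
    (fun y => normal_peak 1 * expR (- 2^-1 * y ^+ 2))
    (normal_peak 1 * (expR (- 2^-1 * x ^+ 2) * - x)) by exact: d3.
rewrite E in d4.
by apply: (is_derive_eq d4); rewrite npdfE -u2 /GRing.scale /=; ring.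
Qed.

Lemma has_derivative_mul_npdf :
  has_derivative (fun x => - (x * npdf x)) (fun x => (x ^+ 2 - 1) * npdf x).
Proof.
move=> x.
have d1 := @is_deriveM _ _ (id : R -> R) npdf x 1 _ _ (is_derive_id _ _)
  (has_derivative_npdf x).
have d2 : is_derive x (1 : R) (fun x => - (x * npdf x)) _ := is_deriveN d1.
by apply: (is_derive_eq d2); rewrite /GRing.scale /=; ring.
Qed.

(* Gaussian decay in the weak form needed here follows from [1 + u <= exp u]
   at [u = x ^+ 2 / 4]. *)
Lemma npdf_decay : exists2 M : R, 0 <= M & forall x,
  [/\ `|x * npdf x| <= M, `|x ^+ 3 * npdf x| <= M &
     `|(x ^+ 2 - 1) * npdf x| <= M].
Proof.
exists (16 * normal_peak 1); first by rewrite mulr_ge0// normal_peak_ge0.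
(* Squaring the exponential inequality gives [q <= expR (x ^+ 2 / 2)], and [16 * q], which is
   [(4 + x ^+ 2) ^+ 2], dominates the three polynomials. *)
move=> x; pose q := (1 + x ^+ 2 / 4) ^+ 2.
have q0 : 0 < q by rewrite exprn_gt0// ltr_pwDl// divr_ge0// sqr_ge0.
have pq : `|npdf x| * q <= normal_peak 1.
  rewrite npdfE normrM ger0_norm ?normal_peak_ge0// ger0_norm ?expR_ge0//.
  rewrite -mulrA ler_piMr ?normal_peak_ge0//.
  rewrite expRN mulrC ler_pdivrMr ?expR_gt0// mul1r.
  rewrite (_ : x ^+ 2 / 2 = 2%:R * (x ^+ 2 / 4)); last by field.
  rewrite expRM_natl ler_sqr ?nnegrE ?expR_ge0 ?expR_ge1Dx//.
  by rewrite addr_ge0// divr_ge0// sqr_ge0.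
have key p : `|p| <= 16 * q -> `|p * npdf x| <= 16 * normal_peak 1.
  move=> pq16; rewrite normrM (le_trans (ler_wpM2r _ pq16))//.
  by rewrite -mulrA ler_wpM2l// mulrC.
have x2 : 0 <= x ^+ 2 by rewrite sqr_ge0.
have xa : `|x| ^+ 2 = x ^+ 2 by rewrite real_normK ?num_real.
split; apply: key; rewrite /q.
- have := normr_ge0 x; rewrite -xa; nra.
- have := normr_ge0 x; rewrite normrX -xa; set y := `|x| => y0.
  rewrite (_ : _ ^+ 3 = y * y ^+ 2); last by ring.
  by have := sqr_ge0 (y - 1); have := sqr_ge0 y; nra.
- rewrite ler_norml; apply/andP; split; nra.
Qed.

End gaussian.

(** * Lindeberg's replacement of summands by normal time *)

Section lindeberg.
Context d (T : measurableType d) (R : realType) (P : probability T R).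
Variable q : T -> R.
Hypotheses (bq : bmf q) (q_mean : \int[P]_x q x = 0)
  (q_var : \int[P]_x (q x ^+ 2) = 1).

Lemma bmf_ncdf d' (U : measurableType d') (f : U -> R) :
  measurable_fun [set: U] f -> bmf (fun x => ncdf (f x)).
Proof.
move=> mf; split; first by apply: measurableT_comp => //; exact: measurable_ncdf.
by exists 1 => x; rewrite ger0_norm ?ncdf_ge0// ncdf_le1.
Qed.

Lemma is_derive_mulr (l y : R) : is_derive l (1 : R) (fun l => l * y) y.
Proof.
have h : is_derive l (1 : R) (fun l => y * l) (y * 1).
  exact: (@is_deriveZ _ _ _ (id : R -> R) y l 1 _ (is_derive_id _ _)).
have E : (fun l : R => y * l) = (fun l => l * y).
  by apply/funext => u; rewrite mulrC.
by rewrite E mulr1 in h.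
Qed.

(** The time [t] of the heat equation is handled through the scale [l = t^(-1/2)], in which the test
    function is just [ncdf (l * y)]. *)
Lemma has_derivative_ncdf_scale (y : R) :
  has_derivative (fun l => ncdf (l * y)) (fun l => y * npdf (l * y)).
Proof.
move=> l; have dl := is_derive_mulr l y.
have h := @is_derive1_comp _ _ _ l _ _ (has_derivative_ncdf (l * y)) dl.
by apply: (is_derive_eq h); rewrite mulrC.
Qed.

Lemma has_derivative_npdf_scale (y : R) :
  has_derivative (fun l => y * npdf (l * y))
    (fun l => - (y ^+ 2 * ((l * y) * npdf (l * y)))).
Proof.
move=> l; have dl := is_derive_mulr l y.
have h := @is_derive1_comp _ _ _ l _ _ (has_derivative_npdf (l * y)) dl.
have h2 := @is_deriveZ _ _ _ _ y l 1 _ h.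
by apply: (is_derive_eq h2); rewrite /GRing.scale /=; ring.
Qed.

(* [(l, y) |-> ncdf (l * y)] solves the heat equation in the time variable
   [l ^- 2], so the averaged second-order term in [a * q] cancels against the
   first-order term in time, leaving an error of order [a ^+ 3]. *)
Lemma lindeberg_step (L : R) : exists2 C : R, 0 <= C &
  forall l l' a y : R, 0 < l' -> l' <= l -> l <= L -> 0 <= a <= 1 ->
    l ^+ 2 - l' ^+ 2 = a ^+ 2 * l ^+ 2 * l' ^+ 2 ->
    `|\int[P]_z ncdf (l * (y - a * q z)) - ncdf (l' * y)| <= C * a ^+ 3.
Proof.
have [M M0 decay] := npdf_decay R.
have [B B0 qB] := bmf_ub bq.
(* For negative [L] the constraints [0 < l' <= l <= L] are contradictory. *)
have [L0|L0] := ltP L 0.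
  exists 0 => // l l' a y l'0 l'l lL; lra.
(* The first term is the third-order remainder in space. The second collects [M * e] from the
   expansion in [l] and [2 * M * e] from the imperfect cancellation, with [e <= L ^+ 4 * a ^+ 3]. *)
exists (M * (L * B) ^+ 3 + 3 * M * L ^+ 4).
  by apply: addr_ge0; apply: mulr_ge0; rewrite ?exprn_ge0 ?mulr_ge0 ?(ltW B0).
move=> l l' a y l'0 l'l lL /andP[a0 a1] heat.
have l0 : 0 < l by exact: lt_le_trans l'l.
set v := l * y.
pose Tay z := ncdf v + npdf v * (- (l * a) * q z) +
  - (v * npdf v) / 2 * (l * a) ^+ 2 * (q z ^+ 2).
have bTay : bmf Tay.
  apply: bmfD; last by apply: bmfM; [exact: bmf_cst|exact: bmfM].
  apply: bmfD; first exact: bmf_cst.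
  by apply: bmfM; [exact: bmf_cst|apply: bmfM => //; exact: bmf_cst].
have bF : bmf (fun z => ncdf (l * (y - a * q z))).
  apply: bmf_ncdf; apply: measurable_funM => //; apply: measurable_funB => //.
  by apply: measurable_funM => //; case: bq.
have intTay : \int[P]_z Tay z = ncdf v - v * npdf v / 2 * (l * a) ^+ 2.
  have b1 : bmf (fun z => npdf v * (- (l * a) * q z)).
    by apply: bmfM; [exact: bmf_cst|apply: bmfM => //; exact: bmf_cst].
  have b2 : bmf (fun z => - (v * npdf v) / 2 * (l * a) ^+ 2 * (q z ^+ 2)).
    by apply: bmfM; [exact: bmf_cst|exact: bmfM].
  have b3 : bmf (fun _ : T => ncdf v) by exact: bmf_cst.
  have b4 : bmf (fun z => - (l * a) * q z) by apply: bmfM => //; exact: bmf_cst.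
  have b5 : bmf (fun z => q z ^+ 2) by exact: bmfM.
  rewrite /Tay bmf_intD//; last exact: bmfD.
  rewrite bmf_intD// probability_int_cst bmf_intZ// bmf_intZ// q_mean bmf_intZ//.
  by rewrite q_var; ring.
have space : `|\int[P]_z ncdf (l * (y - a * q z)) -
    (ncdf v - v * npdf v / 2 * (l * a) ^+ 2)| <= M * (L * B) ^+ 3 * a ^+ 3.
  rewrite -intTay -bmf_intB//; apply: bmf_norm_int_le; first exact: bmfB.
  move=> z; have := taylor2 v (l * (y - a * q z)) (@has_derivative_ncdf R)
    (@has_derivative_npdf R) (@has_derivative_mul_npdf R)
    (fun x => let: And3 _ _ h := decay x in h).
  have -> : l * (y - a * q z) - v = - (l * a) * q z by rewrite /v; ring.
  rewrite (_ : ncdf _ - _ - _ - _ = ncdf (l * (y - a * q z)) - Tay z); last first.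
    by rewrite /Tay; ring.
  move=> /le_trans; apply; rewrite -mulrA ler_wpM2l// -exprMn.
  rewrite ler_pXn2r ?nnegrE ?mulr_ge0 ?(ltW B0)//.
  rewrite !normrM normrN normrM (ger0_norm a0) (gtr0_norm l0).
  rewrite -[leRHS]mulrA [B * a]mulrC mulrA.
  by rewrite ler_pM// ?mulr_ge0 ?(ltW l0)// ler_wpM2r.
pose e := (l - l') ^+ 2 / l' ^+ 2.
have e0 : 0 <= e by rewrite divr_ge0 ?sqr_ge0.
have time : `|ncdf (l' * y) - ncdf v - y * npdf v * (l' - l)| <= M * e.
  have := @taylor1 _ _ _ _ (M / l' ^+ 2) l l' (has_derivative_ncdf_scale y)
    (has_derivative_npdf_scale y).
  rewrite -/v /e.
  rewrite (_ : M * ((l - l') ^+ 2 / l' ^+ 2) =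
    M / l' ^+ 2 * (l' - l) ^+ 2); last by ring.
  apply => c; rewrite (min_idPr l'l) (max_idPl l'l) => /andP[l'c cl].
  have c0 : 0 < c by exact: lt_le_trans l'c.
  have [_ h _] := decay (c * y).
  rewrite (_ : - _ = - (((c * y) ^+ 3 * npdf (c * y)) / c ^+ 2)); last first.
    by field; rewrite gt_eqF.
  rewrite normrN normrM normfV ler_pM//.
  rewrite gtr0_norm ?exprn_gt0// lef_pV2 ?posrE ?exprn_gt0//.
  by rewrite ler_pXn2r// nnegrE ltW.
(* By the relation [heat], [(l * a) ^+ 2] is [(l ^+ 2 - l' ^+ 2) / l' ^+ 2]. The sum then has a
   factor [(l - l') ^+ 2], that is, it is of second order in the change of scale. *)
have cancel : `|v * npdf v / 2 * (l * a) ^+ 2 + y * npdf v * (l' - l)| <=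
    M * (2 * e).
  have [h _ _] := decay v.
  rewrite (_ : _ + _ = v * npdf v * (e * (l + 2 * l') / (2 * l))); last first.
    rewrite (_ : (l * a) ^+ 2 = (l ^+ 2 - l' ^+ 2) / l' ^+ 2); last first.
      by rewrite heat; field; rewrite gt_eqF.
    by rewrite /e /v; field; rewrite !gt_eqF.
  rewrite normrM ler_pM// ger0_norm; last first.
    by apply: divr_ge0; [apply: mulr_ge0 => //; lra|lra].
  rewrite ler_pdivrMr ?mulr_gt0// [leRHS](_ : _ = e * (4 * l)); last by ring.
  by rewrite ler_wpM2l//; lra.
(* The relation [heat] gives [l - l' <= a ^+ 2 * l * l' ^+ 2], so [e] is of order [a ^+ 4], and
   [a <= 1]. *)
have eL : e <= L ^+ 4 * a ^+ 3.
  have dl : l - l' <= a ^+ 2 * l * l' ^+ 2.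
    have : (l - l') * (l + l') = a ^+ 2 * l * l' ^+ 2 * l.
      by rewrite -subr_sqr heat; ring.
    move=> H; rewrite -(ler_pM2r l0) -H ler_wpM2l ?subr_ge0// lerDl ltW//.
  rewrite /e ler_pdivrMr ?exprn_gt0//.
  apply: (@le_trans _ _ ((a ^+ 2 * l * l' ^+ 2) ^+ 2)).
    rewrite ler_pXn2r ?nnegrE ?subr_ge0//.
    by rewrite mulr_ge0 ?sqr_ge0// mulr_ge0 ?sqr_ge0// ltW.
  rewrite (_ : (_ * _) ^+ 2 =
    (a ^+ 4 * (l ^+ 2 * l' ^+ 2)) * l' ^+ 2); last by ring.
  rewrite ler_wpM2r ?sqr_ge0// mulrC ler_pM//.
  - by rewrite mulr_ge0 ?sqr_ge0.
  - by rewrite exprn_ge0.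
  - rewrite (_ : L ^+ 4 = L ^+ 2 * L ^+ 2); last by ring.
    have l'L := le_trans l'l lL.
    by rewrite ler_pM ?sqr_ge0// ler_pXn2r ?nnegrE ?(ltW l0) ?(ltW l'0).
  - by rewrite exprSr ler_piMr// exprn_ge0.
have tri : \int[P]_z ncdf (l * (y - a * q z)) - ncdf (l' * y) =
  (\int[P]_z ncdf (l * (y - a * q z)) - (ncdf v - v * npdf v / 2 * (l * a) ^+ 2))
  - (ncdf (l' * y) - ncdf v - y * npdf v * (l' - l))
  - (v * npdf v / 2 * (l * a) ^+ 2 + y * npdf v * (l' - l)) by ring.
rewrite tri; apply: (le_trans (ler_normB _ _)).
apply: (@le_trans _ _ (M * (L * B) ^+ 3 * a ^+ 3 + M * e + M * (2 * e))).
  apply: lerD => //; apply: (le_trans (ler_normB _ _)); exact: lerD.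
by have := ler_wpM2l M0 eL; lra.
Qed.

(** Induction on [k]: the first coordinate is split off, the hypothesis is used at the shifted point
    [y - a * q x], and one more step moves the time from [t + k * a ^+ 2] to [t + k.+1 * a ^+ 2].
    All times are at least [eps], so a single constant serves every step. *)
Lemma lindeberg_iterate (eps : R) : 0 < eps -> exists2 C : R, 0 <= C &
  forall (a : R) k t y, 0 < a <= 1 -> eps <= t ->
    `|\int[product_power P k]_z
        ncdf ((Num.sqrt t)^-1 * (y - a * \sum_(i < k) q (tnth z i)))
      - ncdf ((Num.sqrt (t + k%:R * a ^+ 2))^-1 * y)| <= k%:R * C * a ^+ 3.
Proof.
move=> eps0; have [C C0 step] := lindeberg_step (Num.sqrt eps)^-1.
exists C => // a k t y /andP[a0 a1] et; elim: k t y et => [|k IH] t y et.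
  under eq_Rintegral do rewrite big_ord0 mulr0 subr0.
  by rewrite probability_int_cst mul0r addr0 subrr normr0 !mul0r.
have bsum n l u : bmf (fun z : n.-tuple T =>
    ncdf (l * (u - a * \sum_(i < n) q (tnth z i)))).
  apply: bmf_ncdf; apply: measurable_funM => //; apply: measurable_funB => //.
  apply: measurable_funM => //; apply: measurable_sum => i.
  by case: (bmf_tnth i bq).
have t0 : 0 < t by exact: lt_le_trans et.
have ta0 : 0 < t + k%:R * a ^+ 2 by rewrite ltr_pwDl// mulr_ge0// sqr_ge0.
have ta1 : 0 < t + k.+1%:R * a ^+ 2 by rewrite ltr_pwDl// mulr_ge0// sqr_ge0.
rewrite product_power_cons//.
set l := (Num.sqrt (t + k%:R * a ^+ 2))^-1.
set l' := (Num.sqrt (t + k.+1%:R * a ^+ 2))^-1.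
have l2 : l ^+ 2 = (t + k%:R * a ^+ 2)^-1 by rewrite exprVn sqr_sqrtr// ltW.
have l'2 : l' ^+ 2 = (t + k.+1%:R * a ^+ 2)^-1 by rewrite exprVn sqr_sqrtr// ltW.
have bIH : bmf (fun x => \int[product_power P k]_z
    ncdf ((Num.sqrt t)^-1 * ((y - a * q x) - a * \sum_(i < k) q (tnth z i)))).
  apply: (@bmf_fubini_F _ _ _ _ _ P (product_power P k) (fun p =>
    ncdf ((Num.sqrt t)^-1 * ((y - a * q p.1) -
                             a * \sum_(i < k) q (tnth p.2 i))))).
  have m1 : measurable_fun [set: T * k.-tuple T] (fun p => q p.1).
    by apply: measurableT_comp => //; case: bq.
  have m2 : measurable_fun [set: T * k.-tuple T]
      (fun p => \sum_(i < k) q (tnth p.2 i)).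
    apply: measurable_sum => i.
    apply: (@measurableT_comp _ _ _ _ _ _ (fun z => q (tnth z i)) _ snd) => //.
    by case: (bmf_tnth i bq).
  apply: bmf_ncdf; apply: measurable_funM => //; apply: measurable_funB.
    by apply: measurable_funB => //; apply: measurable_funM.
  exact: measurable_funM.
have bl : bmf (fun x => ncdf (l * (y - a * q x))).
  apply: bmf_ncdf; apply: measurable_funM => //; apply: measurable_funB => //.
  by apply: measurable_funM => //; case: bq.
pose I := \int[P]_x \int[product_power P k]_z
  ncdf ((Num.sqrt t)^-1 * ((y - a * q x) - a * \sum_(i < k) q (tnth z i))).
(* In [J] the last [k] summands have already been traded for time. *)
pose J := \int[P]_x ncdf (l * (y - a * q x)).
have first : `|I - J| <= k%:R * C * a ^+ 3.
  rewrite -bmf_intB//; apply: bmf_norm_int_le; first exact: bmfB.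
  by move=> x; exact: IH.
have second : `|J - ncdf (l' * y)| <= C * a ^+ 3.
  apply: step.
  - by rewrite invr_gt0 sqrtr_gt0.
  - rewrite /l /l' lef_pV2 ?posrE ?sqrtr_gt0// ler_wsqrtr//.
    by rewrite lerD2l ler_wpM2r ?sqr_ge0// ler_nat.
  - rewrite /l lef_pV2 ?posrE ?sqrtr_gt0// ler_wsqrtr//.
    by rewrite (le_trans et)// lerDl mulr_ge0// sqr_ge0.
  - by rewrite (ltW a0) a1.
  - rewrite l2 l'2 -[k.+1%:R]natr1; field.
    by rewrite natr1 !gt_eqF.
rewrite (_ : \int[P]_x _ = I); last first.
  apply: eq_Rintegral => x _; apply: eq_Rintegral => z _.
  rewrite big_ord_recl tnth0 [a * (_ + _)]mulrDr opprD addrA.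
  by under eq_bigr do rewrite tnthS.
have -> : I - ncdf (l' * y) = (I - J) + (J - ncdf (l' * y)) by ring.
rewrite (le_trans (ler_normD _ _))// -natr1 (le_trans (lerD first second))//.
by rewrite le_eqVlt; apply/orP; left; apply/eqP; ring.
Qed.

End lindeberg.

(** * Convergence in probability and in distribution *)

Lemma cvgr_near_le (R : realType) (T : Type) (F : set_system T)
    {FF : Filter F} (f : T -> R) (y e : R) :
  f @ F --> y -> 0 < e -> \forall x \near F, `|y - f x| <= e.
Proof. by move=> /cvgrPdist_le; exact. Qed.

Section convergence_in_probability.
Context d (Omega : measurableType d) (R : realType) (Pr : probability Omega R).
Implicit Types (X Y S : nat -> Omega -> R) (A B C : set Omega).

Definition pr A : R := fine (Pr A).

Lemma pr_int A : measurable A -> pr A = \int[Pr]_w \1_A w.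
Proof. exact: fine_measure_int. Qed.

Lemma le_pr A B : measurable A -> measurable B -> A `<=` B -> pr A <= pr B.
Proof.
by move=> mA mB AB; rewrite fine_le ?fin_num_measure// le_measure ?inE.
Qed.

Lemma pr_cover A B C : measurable A -> measurable B -> measurable C ->
  A `<=` B `|` C -> pr A <= pr B + pr C.
Proof.
move=> mA mB mC ABC; apply: le_trans (le_pr mA (measurableU _ _ mB mC) ABC) _.
rewrite -fineD ?fin_num_measure// fine_le//.
- by rewrite fin_num_measure//; exact: measurableU.
- by rewrite fin_numD !fin_num_measure.
- exact: measureU2.
Qed.

Lemma measurable_far (f : Omega -> R) c e : measurable_fun [set: Omega] f ->
  measurable [set w | e < `|f w - c|].
Proof.
move=> mf; apply: measurable_gt_set; apply: measurableT_comp => //.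
exact: measurable_funB.
Qed.

Definition cvg_prob X c : Prop :=
  (forall n, measurable_fun [set: Omega] (X n)) /\
  forall e p : R, 0 < e -> 0 < p ->
    \forall n \near \oo, pr [set w | e < `|X n w - c|] <= p.

(** By Chebyshev's inequality, as the second moment of the error is at most [K / n]. *)
Lemma cvg_prob_second_moment X c (K : R) (N : nat) :
  (forall n, bmf (fun w => X n w - c)) ->
  (forall n, (N <= n)%N -> n%:R * \int[Pr]_w ((X n w - c) ^+ 2) <= K) ->
  cvg_prob X c.
Proof.
move=> bX XK; split=> [n|e p e0 p0].
  have -> : X n = (fun w => (X n w - c) + c) by apply/funext => w; rewrite subrK.
  by apply: measurable_funD => //; case: (bX n).
near=> n.
apply: le_trans (markov_sqr Pr (bX n) e0) _.
have n0 : 0 < n%:R :> R by rewrite ltr0n; near: n; exact: nbhs_infty_gt.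
have /XK XKn : (N <= n)%N by near: n; exact: nbhs_infty_ge.
rewrite ler_pdivrMl ?exprn_gt0// -(ler_pM2l n0) (le_trans XKn)//.
rewrite -ler_pdivrMr ?mulr_gt0 ?exprn_gt0//.
by near: n; exact: nbhs_infty_ger.
Unshelve. all: by end_near. Qed.

(** The condition is uniform in [w] and asked only for [n >= N], so the lemma serves both as a
    continuous mapping theorem and for sequences that agree eventually. *)
Lemma cvg_prob_map X Y c c' (N : nat) :
  (forall n, measurable_fun [set: Omega] (Y n)) ->
  (forall e, 0 < e -> exists2 e', 0 < e' & forall n w, (N <= n)%N ->
     `|X n w - c| <= e' -> `|Y n w - c'| <= e) ->
  cvg_prob X c -> cvg_prob Y c'.
Proof.
move=> mY XY [mX cX]; split => // e p e0 p0.
have [e' e'0 h] := XY e e0.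
near=> n.
have ne : pr [set w | e' < `|X n w - c|] <= p by near: n; exact: cX.
apply: le_trans ne; apply: le_pr; [exact: measurable_far|exact: measurable_far|].
move=> w /=; rewrite ltNge => /negP far; rewrite ltNge; apply/negP => near.
by apply/far/(h n) => //; near: n; exact: nbhs_infty_ge.
Unshelve. all: by end_near. Qed.

Lemma cvg_prob_map2 X1 X2 Y c1 c2 c' (N : nat) :
  (forall n, measurable_fun [set: Omega] (Y n)) ->
  (forall e, 0 < e -> exists2 e', 0 < e' & forall n w, (N <= n)%N ->
     `|X1 n w - c1| <= e' -> `|X2 n w - c2| <= e' -> `|Y n w - c'| <= e) ->
  cvg_prob X1 c1 -> cvg_prob X2 c2 -> cvg_prob Y c'.
Proof.
move=> mY XY [mX1 cX1] [mX2 cX2]; split => // e p e0 p0.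
have [e' e'0 h] := XY e e0; have p20 : 0 < p / 2 by rewrite divr_gt0.
near=> n.
have ne1 : pr [set w | e' < `|X1 n w - c1|] <= p / 2 by near: n; exact: cX1.
have ne2 : pr [set w | e' < `|X2 n w - c2|] <= p / 2 by near: n; exact: cX2.
rewrite [leRHS]splitr; apply: le_trans (lerD ne1 ne2).
apply: pr_cover; [exact: measurable_far..|].
move=> w /=; rewrite ltNge => /negP far.
have [far1|near1] := ltP e' `|X1 n w - c1|; [by left|right].
rewrite ltNge; apply/negP => near2.
by apply/far/(h n) => //; near: n; exact: nbhs_infty_ge.
Unshelve. all: by end_near. Qed.

Lemma cvg_prob_cst c : cvg_prob (fun _ _ => c) c.
Proof.
split => // e p e0 p0; near=> n; rewrite (_ : [set _ | _] = set0).
  by rewrite /pr measure0 ltW.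
by apply/seteqP; split => w //=; rewrite subrr normr0 ltNge ltW.
Unshelve. all: by end_near. Qed.

Lemma cvg_probD X Y a b : cvg_prob X a -> cvg_prob Y b ->
  cvg_prob (fun n w => X n w + Y n w) (a + b).
Proof.
move=> cX cY; apply: (cvg_prob_map2 (N := 0%N) _ _ cX cY).
  by move=> n; apply: measurable_funD; [case: cX|case: cY].
move=> e e0; exists (e / 2); first by rewrite divr_gt0.
move=> n w _ ha hb.
rewrite [leRHS]splitr (_ : _ - _ = (X n w - a) + (Y n w - b)); last by ring.
by rewrite (le_trans (ler_normD _ _))// lerD.
Qed.

Lemma cvg_probM X Y a b : cvg_prob X a -> cvg_prob Y b ->
  cvg_prob (fun n w => X n w * Y n w) (a * b).
Proof.
move=> cX cY; apply: (cvg_prob_map2 (N := 0%N) _ _ cX cY).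
  by move=> n; apply: measurable_funM; [case: cX|case: cY].
move=> e e0; pose K := `|a| + `|b| + 1.
have K0 : 0 < K by rewrite /K; have := normr_ge0 a; have := normr_ge0 b; lra.
(* The bound 1 makes the product of the two errors at most [e / K], and the three error terms then
   add up to [e]. *)
exists (Num.min 1 (e / K)).
  by rewrite lt_min ltr01 divr_gt0.
move=> n w _; rewrite !le_min => /andP[ha1 haK] /andP[hb1 hbK].
have -> : X n w * Y n w - a * b =
  (X n w - a) * (Y n w - b) + a * (Y n w - b) + (X n w - a) * b by ring.
have eK : e / K * K = e by rewrite divfK// gt_eqF.
apply: (@le_trans _ _ (1 * (e / K) + `|a| * (e / K) + (e / K) * `|b|)).
  apply: le_trans (ler_normD _ _) _; apply: lerD; last first.
    by rewrite normrM ler_wpM2r.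
  apply: le_trans (ler_normD _ _) _; apply: lerD; last first.
    by rewrite normrM ler_wpM2l.
  by rewrite normrM ler_pM.
rewrite -[leRHS]eK /K; lra.
Qed.

Lemma cvg_prob_seq (u : nat -> R) (c : R) : u n @[n --> \oo] --> c ->
  cvg_prob (fun n _ => u n) c.
Proof.
move=> uc; split => // e p e0 p0.
near=> n; have ucn : `|c - u n| <= e by near: n; exact: cvgr_near_le.
rewrite (_ : [set _ | _] = set0); first by rewrite /pr measure0 ltW.
by apply/seteqP; split => w //=; rewrite distrC ltNge ucn.
Unshelve. all: by end_near. Qed.

Lemma cvg_prob_sum (I : Type) (r : seq I) (X : I -> nat -> Omega -> R)
    (c : I -> R) : (forall i, cvg_prob (X i) (c i)) ->
  cvg_prob (fun n w => \sum_(i <- r) X i n w) (\sum_(i <- r) c i).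
Proof.
move=> cX; elim: r => [|i r IH].
  rewrite big_nil; have := cvg_prob_cst 0; congr (cvg_prob _ _).
  by apply/funext => n; apply/funext => w; rewrite big_nil.
rewrite big_cons; have := cvg_probD (cX i) IH; congr (cvg_prob _ _).
by apply/funext => n; apply/funext => w; rewrite big_cons.
Qed.

Lemma cvg_prob_ae X Y c : (forall n, measurable_fun [set: Omega] (Y n)) ->
  (forall n, {ae Pr, forall w, X n w = Y n w}) ->
  cvg_prob X c -> cvg_prob Y c.
Proof.
move=> mY XY [mX cX]; split => // e p e0 p0.
have := cX e p e0 p0; apply: filterS => n; apply: le_trans.
have [N [mN N0 XYN]] := XY n.
have -> : pr [set w | e < `|X n w - c|] =
    pr [set w | e < `|X n w - c|] + pr N by rewrite [pr N]/pr N0 addr0.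
apply: pr_cover => //; [exact: measurable_far|exact: measurable_far|].
move=> w /= far; have [->|/eqP ne] := eqVneq (X n w) (Y n w); first by left.
by right; apply: XYN.
Qed.

(* Chebyshev's bound on [S] keeps the multiplicative error [B n - 1] from
   being amplified. *)
Lemma slutsky (A B S : nat -> Omega -> R) (K : R) (N : nat) :
  (forall n, bmf (S n)) ->
  (forall n, (N <= n)%N -> \int[Pr]_w (S n w ^+ 2) <= K) ->
  cvg_prob (fun n w => A n w - S n w) 0 -> cvg_prob B 1 ->
  (forall n, measurable_fun [set: Omega] (A n)) ->
  cvg_prob (fun n w => A n w * B n w - S n w) 0.
Proof.
move=> bS SK cAS cB mA.
have mS n : measurable_fun [set: Omega] (S n) by case: (bS n).
split=> [n|e p e0 p0].
  by apply: measurable_funB => //; apply: measurable_funM => //; case: cB.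
have p20 : 0 < p / 2 by rewrite divr_gt0.
have K0 : 0 <= K.
  apply: le_trans (SK N (leqnn N)).
  by apply: Rintegral_ge0 => w _; exact: sqr_ge0.
(* [H] is the level that [S n] exceeds with probability at most [p / 2]. *)
have [H H0 HK] : exists2 H : R, 0 < H & H ^- 2 * K <= p / 2.
  exists (1 + K / (p / 2)); first by rewrite ltr_pwDl// divr_ge0// ltW.
  have u0 : 0 <= K / (p / 2) by rewrite divr_ge0// ltW.
  rewrite ler_pdivrMl ?exprn_gt0 ?ltr_pwDl// -ler_pdivrMr//.
  by set u := K / _ in u0 *; nra.
(* The decomposition is [A * B - S = (A - S) + (A - S) * (B - 1) + S * (B - 1)]; the first two terms
   tend to 0 directly, the last on the event where [S] is at most [H] in absolute value. *)
have cc := cvg_probD cAS (cvg_probM cAS (cvg_probD cB (cvg_prob_cst (-1)))).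
rewrite !mul0r addr0 in cc.
have [_ cc'] := cc; have [mB cB'] := cB.
have e20 : 0 < e / 2 by rewrite divr_gt0.
have eH : 0 < e / 2 / H by rewrite divr_gt0.
have p40 : 0 < p / 2 / 2 by rewrite divr_gt0.
near=> n.
have h1 : pr [set w | e / 2 < `|A n w - S n w +
    (A n w - S n w) * (B n w - 1) - 0|] <= p / 2 / 2 by near: n; exact: cc'.
have h2 : pr [set w | e / 2 / H < `|B n w - 1|] <= p / 2 / 2.
  by near: n; exact: cB'.
have h3 : pr [set w | H < `|S n w - 0|] <= p / 2.
  apply: le_trans HK; under eq_set do rewrite subr0.
  apply: le_trans (markov_sqr Pr (bS n) H0) _.
  rewrite ler_wpM2l ?invr_ge0 ?sqr_ge0//; apply: SK.
  by near: n; exact: nbhs_infty_ge.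
have mAB : measurable_fun [set: Omega]
    (fun w => A n w - S n w + (A n w - S n w) * (B n w - 1)).
  by apply: measurable_funD; [exact: measurable_funB|
    apply: measurable_funM; exact: measurable_funB].
have mT : measurable_fun [set: Omega] (fun w => A n w * B n w - S n w).
  by apply: measurable_funB => //; exact: measurable_funM.
have m12 := measurableU _ _ (measurable_far 0 (e / 2) mAB)
                            (measurable_far 1 (e / 2 / H) (mB n)).
apply: (@le_trans _ _ (p / 2 / 2 + p / 2 / 2 + p / 2)); last lra.
apply: le_trans (lerD _ h3); last first.
  exact: le_trans (pr_cover m12 (measurable_far 0 (e / 2) mAB)
    (measurable_far 1 (e / 2 / H) (mB n)) (@subset_refl _ _)) (lerD h1 h2).
apply: pr_cover => //; [exact: measurable_far|exact: measurable_far|].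
move=> w /=; rewrite !subr0 => far.
have [farS|nearS] := ltP H `|S n w|; [by right|left].
have [far1|near1] := ltP (e / 2) `|A n w - S n w + (A n w - S n w) * (B n w - 1)|.
  by left.
right; rewrite ltNge; apply/negP => nearB.
move: far; rewrite ltNge => /negP; apply.
have -> : A n w * B n w - S n w =
  (A n w - S n w + (A n w - S n w) * (B n w - 1)) + S n w * (B n w - 1) by ring.
rewrite (le_trans (ler_normD _ _))// [leRHS]splitr lerD// normrM.
apply: (@le_trans _ _ (H * (e / 2 / H))); first exact: ler_pM.
by rewrite mulrC divfK// gt_eqF.
Unshelve. all: by end_near. Qed.

(** Smoothing by a normal variable of standard deviation [h ^+ 2] is negligible against a shift by
    [h], which amounts to [h^-1] standard deviations, while both vanish with [h]. *)
Lemma smoothing_scale (x e : R) : 0 < e -> exists2 h : R, 0 < h &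
  [/\ `|ncdf ((Num.sqrt (1 + h ^+ 4))^-1 * (x + 2 * h)) - ncdf x| <= e,
     `|ncdf ((Num.sqrt (1 + h ^+ 4))^-1 * (x - 2 * h)) - ncdf x| <= e,
     1 - ncdf h^-1 <= e & ncdf (- h^-1) <= e].
Proof.
move=> e0.
have cont (s : R) :
    \forall h \near 0^'+, `|ncdf ((Num.sqrt (1 + h ^+ 4))^-1 * (x + s * h)) -
      ncdf x| <= e.
  have lim : ncdf ((Num.sqrt (1 + h ^+ 4))^-1 * (x + s * h)) @[h --> 0^'+] -->
      ncdf x.
    apply: cvg_at_right_filter.
    have c1 : {for (0 : R), continuous (fun h : R => 1 + h ^+ 4)}.
      by apply: cvgD; [exact: cvg_cst|exact: exprn_continuous].
    have c2 := continuous_comp c1 (@sqrt_continuous R _).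
    have c3 : {for (0 : R), continuous
        (fun h : R => (Num.sqrt (1 + h ^+ 4))^-1 * (x + s * h))}.
      apply: cvgM; last first.
        apply: cvgD; first exact: cvg_cst.
        by apply: cvgM; [exact: cvg_cst|exact: cvg_id].
      by apply: cvgV => //; rewrite expr0n addr0 sqrtr1 oner_eq0.
    have c4 := continuous_comp c3 (@continuous_ncdf R _).
    have E : ncdf x = ncdf ((Num.sqrt (1 + (0:R) ^+ 4))^-1 * (x + s * 0)).
      by rewrite expr0n mulr0 !addr0 sqrtr1 invr1 mul1r.
    by rewrite [X in _ --> X]E.
  by near=> h; rewrite distrC; near: h; exact: cvgr_near_le.
have [A [_ hA]] := cvgr_near_le (@ncdf_cvgy R) e0.
have [B [_ hB]] := cvgr_near_le (@ncdf_cvgNy R) e0.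
pose C := Num.max 1 (Num.max (A + 1) (1 - B)).
have C0 : 0 < C by rewrite /C lt_max ltr01.
near (0 : R)^'+ => h; exists h; first by near: h; exact: nbhs_right_gt.
have h0 : 0 < h by near: h; exact: nbhs_right_gt.
have hC : C <= h^-1.
  rewrite -[C]invrK lef_pV2 ?posrE ?invr_gt0//.
  by near: h; apply: nbhs_right_le; rewrite invr_gt0.
move: hC; rewrite /C !ge_max => /and3P[_ CA CB].
split.
- by near: h; exact: cont.
- have E : x - 2 * h = x + (- 2) * h by ring.
  by rewrite E; near: h; exact: cont.
- have /hA /ler_normlW// : A < h^-1 by lra.
- have /hB : - h^-1 < B by lra.
  by rewrite sub0r normrN => /ler_normlW.
Unshelve. all: by end_near. Qed.

(** Indicators of half-lines are sandwiched between smoothed ones. Four errors of [e / 4] arise on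
    each side: the distance between [T] and [S], the smoothing, the limit of the smoothed
    expectation, and the change from its limit to [ncdf x]. *)
Lemma cvg_in_distribution_normal (S T : nat -> Omega -> R) :
  (forall n, measurable_fun [set: Omega] (S n)) ->
  (forall n, measurable_fun [set: Omega] (T n)) ->
  (forall s y : R, 0 < s ->
     \int[Pr]_w ncdf ((Num.sqrt s)^-1 * (y - S n w)) @[n --> \oo] -->
     ncdf ((Num.sqrt (1 + s))^-1 * y)) ->
  cvg_prob (fun n w => T n w - S n w) 0 ->
  cvg_in_distribution Pr T (normal_prob 0 1).
Proof.
move=> mS mT smooth [_ cTS]; split => // x _.
rewrite [X in _ --> X](_ : _ = (ncdf x)%:E); last exact: ncdfE.
apply: cvg_EFin.
  near=> n; rewrite fin_num_measure//; exact: measurable_le_set.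
apply/cvgrPdist_le => e e0.
have e40 : 0 < e / 4 by rewrite divr_gt0.
have [h h0 scales] := smoothing_scale x e40.
have h40 : 0 < h ^+ 4 by rewrite exprn_gt0.
have sq : Num.sqrt (h ^+ 4) = h ^+ 2.
  by rewrite (_ : h ^+ 4 = (h ^+ 2) ^+ 2) ?sqrtr_sqr ?ger0_norm ?sqr_ge0//; ring.
have bF n y : bmf (fun w => ncdf ((Num.sqrt (h ^+ 4))^-1 * (y - S n w))).
  by apply: bmf_ncdf; apply: measurable_funM => //; exact: measurable_funB.
have scale (u : R) : h <= u -> h^-1 <= (h ^+ 2)^-1 * u.
  move=> hu; rewrite (_ : h^-1 = (h ^+ 2)^-1 * h); last by field; rewrite gt_eqF.
  by rewrite ler_wpM2l// invr_ge0 sqr_ge0.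
have bc (c : R) : bmf (fun _ : Omega => c) by exact: bmf_cst.
have approx y : \forall n \near \oo, `|ncdf ((Num.sqrt (1 + h ^+ 4))^-1 * y) -
    \int[Pr]_w ncdf ((Num.sqrt (h ^+ 4))^-1 * (y - S n w))| <= e / 4.
  exact: cvgr_near_le (smooth _ _ h40) e40.
have far_up (t s : R) : t <= x -> x + h < s -> h < `|t - s|.
  by move=> ? ?; rewrite ltr0_norm; lra.
have far_dn (t s : R) : s <= x - h -> x < t -> h < `|t - s|.
  by move=> ? ?; rewrite gtr0_norm; lra.
(* One [h] pays for passing from [T] to [S], the other for smoothing the indicator. *)
pose yu := x + 2 * h; pose yd := x - 2 * h.
have gap_up (s : R) : s <= x + h -> h <= yu - s by rewrite /yu => ?; lra.
have gap_dn (s : R) : x - h < s -> h <= - (yd - s) by rewrite /yd => ?; lra.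
near=> n.
have mle (f : Omega -> R) c : measurable_fun [set: Omega] f ->
  measurable [set w | f w <= c] by exact: measurable_le_set.
have far : pr [set w | h < `|T n w - S n w - 0|] <= e / 4.
  by near: n; exact: cTS.
have lims :
    `|ncdf ((Num.sqrt (1 + h ^+ 4))^-1 * yu) -
      \int[Pr]_w ncdf ((Num.sqrt (h ^+ 4))^-1 * (yu - S n w))| <= e / 4 /\
    `|ncdf ((Num.sqrt (1 + h ^+ 4))^-1 * yd) -
      \int[Pr]_w ncdf ((Num.sqrt (h ^+ 4))^-1 * (yd - S n w))| <= e / 4.
  near: n; exact: filterI (approx yu) (approx yd).
have mfar : measurable [set w | h < `|T n w - S n w - 0|].
  by apply: measurable_far; exact: measurable_funB.
have upper : pr [set w | T n w <= x] <= pr [set w | S n w <= x + h] + e / 4.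
  apply: le_trans (lerD (lexx _) far).
  apply: pr_cover => //; [exact: mle|exact: mle|].
  move=> w /= Tx; have [Sx|Sx] := leP (S n w) (x + h); [by left|right].
  by rewrite subr0; exact: far_up.
have lower : pr [set w | S n w <= x - h] <= pr [set w | T n w <= x] + e / 4.
  apply: le_trans (lerD (lexx _) far).
  apply: pr_cover => //; [exact: mle|exact: mle|].
  move=> w /= Sx; have [Tx|Tx] := leP (T n w) x; [by left|right].
  by rewrite subr0; exact: far_dn.
have smoothup : pr [set w | S n w <= x + h] <=
    \int[Pr]_w ncdf ((Num.sqrt (h ^+ 4))^-1 * (yu - S n w)) + e / 4.
  rewrite pr_int; last exact: mle.
  rewrite -[e / 4](probability_int_cst Pr) -bmf_intD//.
  apply: bmf_le_int; [by apply/bmf_indic/mle|exact: bmfD|].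
  move=> w; rewrite indicE; case: (boolP (w \in _)) => [|_] /=; last first.
    by rewrite addr_ge0 ?ncdf_ge0 ?ltW.
  rewrite inE /= sq => /gap_up /scale /ncdf_le le_ncdf.
  case: scales => _ _ gt _; rewrite -lerBlDr (le_trans _ le_ncdf)// lerBlDr.
  by rewrite -lerBlDl.
have smoothdn : \int[Pr]_w ncdf ((Num.sqrt (h ^+ 4))^-1 * (yd - S n w)) <=
    pr [set w | S n w <= x - h] + e / 4.
  rewrite pr_int; last exact: mle.
  rewrite -[e / 4](probability_int_cst Pr) -bmf_intD//; last exact/bmf_indic/mle.
  apply: bmf_le_int; [exact: bF|by apply: bmfD => //; apply/bmf_indic/mle|].
  move=> w; rewrite indicE; case: (boolP (w \in _)) => [_|] /=.
    by rewrite (le_trans (ncdf_le1 _))// lerDl ltW.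
  rewrite notin_setE /= sq => /negP; rewrite -ltNge => /gap_dn /scale.
  rewrite mulrN lerNr => /ncdf_le le_ncdf.
  by case: scales => _ _ _ lt; rewrite add0r (le_trans le_ncdf).
rewrite /= -/(pr _); case: lims scales => limup limdn [up dn _ _].
move: limup limdn up dn upper lower smoothup smoothdn.
rewrite -/yu -/yd; move: (ncdf x) (ncdf _) (ncdf _) (\int[Pr]_w _) (\int[Pr]_w _).
move: (pr _) (pr _) (pr _) => p1 p2 p3 c cu cd iu id.
rewrite !ler_norml => /andP[? ?] /andP[? ?] /andP[? ?] /andP[? ?] ? ? ? ?.
by apply/andP; split; lra.
Unshelve. all: by end_near. Qed.

End convergence_in_probability.

(** * Kernels built from the loss difference *)

Lemma ae_forall_fin d (T : measurableType d) (R : realType)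
    (mu : {measure set T -> \bar R}) (I : finType) (Q : I -> T -> Prop) :
  (forall i, {ae mu, forall x, Q i x}) -> {ae mu, forall x, forall i, Q i x}.
Proof.
move=> aeQ.
have := @ae_foralln _ _ _ mu
  (fun n x => forall i, @choice.unpickle I n = Some i -> Q i x).
have h n : {ae mu, forall x, forall i, @choice.unpickle I n = Some i -> Q i x}.
  case: (@choice.unpickle I n) => [i|]; last exact: aeW.
  by apply: filterS (aeQ i) => x Qx _ [<-].
move=> /(_ h); apply: filterS => x Qx i; apply: (Qx (@choice.pickle I i)).
by rewrite choice.pickleK.
Qed.

Section kernel_symmetry.
Context d (T : measurableType d) (R : realType) (g : nat).
Let m := g.+1.
Implicit Types (Phi : g.-tuple T -> T -> R) (z : m.-tuple T).

Lemma perm_leave_out (i : 'I_m) z : perm_eq (tnth z i :: leave_out i z) z.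
Proof.
rewrite -[X in perm_eq _ X](map_tnth_enum z).
have -> : tnth z i :: leave_out i z =
    [seq tnth z j | j <- i :: [seq lift i j | j <- enum 'I_g]].
  by rewrite /= -map_comp.
apply: perm_map; apply: uniq_perm; last 2 first.
- exact: enum_uniq.
- move=> j; rewrite mem_enum inE.
  case: (unliftP i j) => [k ->|->]; rewrite ?eqxx//.
  by rewrite (mem_map lift_inj) mem_enum orbT.
- rewrite /= map_inj_uniq ?enum_uniq ?andbT; last exact: lift_inj.
  by apply/negP => /mapP[k _ /eqP]; rewrite (negbTE (neq_lift i k)).
Qed.

Definition permutation_invariant Phi :=
  forall (l l' : g.-tuple T) x, perm_eq l l' -> Phi l x = Phi l' x.

(** Adding the entry [tnth z (p i)] to either side yields a rearrangement of [z]. *)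
Lemma leave_out_perm (p : 'S_m) (i : 'I_m) z :
  perm_eq (leave_out i [tuple tnth z (p j) | j < m]) (leave_out (p i) z).
Proof.
rewrite -(perm_cons (tnth z (p i))).
apply: (perm_trans _ (_ : perm_eq z _)); last by rewrite perm_sym perm_leave_out.
apply: (@perm_trans _ [tuple tnth z (p j) | j < m]).
  have := perm_leave_out i [tuple tnth z (p j) | j < m].
  by rewrite tnth_mktuple.
by apply/tuple_permP; exists p.
Qed.

Lemma symmetric_Phi0 Phi : permutation_invariant Phi ->
  symmetric_kernel (Phi0 Phi).
Proof.
move=> inv z z' /tuple_permP[p zp].
have -> : z = [tuple tnth z' (p j) | j < m] by apply: val_inj.
congr (_ * _); rewrite [RHS](reindex_inj (@perm_inj _ p)).
apply: eq_bigr => i _; rewrite tnth_mktuple; apply: inv; exact: leave_out_perm.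
Qed.

Lemma val_first_of k (s : seq T) : (k <= size s)%N ->
  first_of k s = take k s :> seq T.
Proof.
move=> ks; apply: (@eq_from_nth _ point).
  by rewrite size_tuple size_takel.
move=> i; rewrite size_tuple => ik; rewrite nth_take//.
by rewrite -[i]/(val (Ordinal ik)) -tnth_nth tnth_mktuple.
Qed.

Lemma card_tuples_of_set n k (S : {set 'I_n}) : #|S| = k ->
  #|[set s : k.-tuple 'I_n | uniq s & [set x in s]%SET == S]%SET| = k`!.
Proof.
move=> Sk; have <- : size (permutations (enum S)) = k`!.
  by rewrite size_permutations ?enum_uniq// -cardE Sk.
rewrite cardE -(size_map val); apply/perm_size/uniq_perm.
- by rewrite map_inj_uniq ?enum_uniq//; exact: val_inj.
- exact: permutations_uniq.
- move=> t; rewrite mem_permutations; apply/mapP/idP => [[s + ->]|tS].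
    rewrite mem_enum inE => /andP[us /eqP sS].
    apply: uniq_perm => //; first exact: enum_uniq.
    by move=> x; rewrite mem_enum -sS inE.
  have tk : size t == k by rewrite (perm_size tS) -cardE Sk.
  exists (Tuple tk) => //; rewrite mem_enum inE /= (perm_uniq tS) enum_uniq /=.
  by apply/eqP/setP => x; rewrite inE (perm_mem tS) mem_enum.
Qed.

(** Each subset of size [m] arises from [m!] tuples, on which the symmetric kernel takes one
    value. *)
Lemma Delta_hatE Phi n (z : nat -> T) : permutation_invariant Phi ->
  Delta_hat Phi n z = U_stat (Phi0 Phi) n z.
Proof.
move=> inv; rewrite U_statE /Delta_hat num_uniqE -bin_ffact natrM.
have E : \sum_(s : m.-tuple 'I_n | uniq s) Phi0 Phi (obs (labels s) z) =
    (m`!)%:R * \sum_(S : {set 'I_n} | #|S| == m)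
      Phi0 Phi (first_of m [seq z i | i : 'I_n in S]).
  rewrite (partition_big (fun s : m.-tuple 'I_n => [set x in s]%SET)
    (fun S => #|S| == m)) /=; last first.
    by move=> s us; rewrite cardsE (card_uniqP us) size_tuple.
  rewrite mulr_sumr; apply: eq_bigr => S /eqP Sm.
  rewrite (eq_bigr (fun=> Phi0 Phi (first_of m [seq z i | i : 'I_n in S]))).
    rewrite sumr_const -[LHS]mulr_natl -(card_tuples_of_set Sm).
    by congr (_%:R * _); apply: eq_card => s; rewrite !inE.
  move=> s /andP[us /eqP sS]; apply: symmetric_Phi0 => //.
  rewrite val_obs val_first_of; last by rewrite size_map -cardE Sm.
  rewrite take_oversize; last by rewrite size_map -cardE Sm.
  rewrite /labels /= -map_comp; apply: perm_map; apply: uniq_perm => //.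
    exact: enum_uniq.
  by move=> x; rewrite mem_enum -sS inE.
rewrite E invfM [RHS]mulrC -mulrA mulKf//.
Qed.

Definition uncurried Phi (p : g.-tuple T * T) : R := Phi p.1 p.2.

Lemma measurable_leave_out (i : 'I_m) :
  measurable_fun [set: m.-tuple T] (@leave_out _ T g i).
Proof.
apply/measurable_fun_tnthP => j.
rewrite (_ : _ \o _ = (fun z => tnth z (lift i j))).
  exact: measurable_tnth.
by apply/funext => z /=; rewrite tnth_mktuple.
Qed.

Lemma measurable_Phi_at Phi (i : 'I_m) :
  measurable_fun [set: _] (uncurried Phi) ->
  measurable_fun [set: m.-tuple T]
    (fun z => Phi (leave_out i z) (tnth z i)).
Proof.
move=> mPhi.
apply: (@measurableT_comp _ _ _ _ _ _ (uncurried Phi) _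
  (fun z => (leave_out i z, tnth z i))) => //.
apply: measurable_fun_pair; first exact: measurable_leave_out.
exact: measurable_tnth.
Qed.

Lemma measurable_Phi0 Phi : measurable_fun [set: _] (uncurried Phi) ->
  measurable_fun [set: m.-tuple T] (Phi0 Phi).
Proof.
move=> mPhi; apply: measurable_funM => //; apply: measurable_sum => i.
exact: measurable_Phi_at.
Qed.

Lemma measurable_first_of k l (e : nat) : (e + k <= l)%N ->
  measurable_fun [set: l.-tuple T] (fun y => first_of k (drop e y)).
Proof.
move=> kl; apply/measurable_fun_tnthP => i.
have il : (e + i < l)%N by rewrite (leq_trans _ kl)// ltn_add2l.
rewrite (_ : _ \o _ = (fun y : l.-tuple T => tnth y (Ordinal il))).
  exact: measurable_tnth.
by apply/funext => y /=; rewrite tnth_mktuple nth_drop (tnth_nth point).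
Qed.

Lemma measurable_overlap Phi c : (c <= m)%N ->
  measurable_fun [set: _] (uncurried Phi) ->
  measurable_fun [set: (2 * m - c).-tuple T] (@overlap _ _ _ _ Phi c).
Proof.
move=> cm mPhi; have mPhi0 := measurable_Phi0 mPhi.
apply: measurable_funM; apply: measurableT_comp => //.
  under eq_fun do rewrite -[tval _]drop0.
  by apply: measurable_first_of; lia.
by apply: measurable_first_of; lia.
Qed.

End kernel_symmetry.

(** * Limits and sum of the hypergeometric weights *)

Section hypergeometric_weights.
Context (R : realType) (g : nat).
Let m := g.+1.

Lemma cvg_invn : ((n%:R)^-1 : R) @[n --> \oo] --> (0 : R).
Proof.
apply/gtr0_cvgV0; last exact: cvgr_idn.
by near=> n; rewrite ltr0n; near: n; exact: nbhs_infty_gt.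
Unshelve. all: by end_near. Qed.

Lemma ffact_ratio_cvg b k :
  (((n - b) ^_ k)%:R / n%:R ^+ k : R) @[n --> \oo] --> (1 : R).
Proof.
elim: k => [|k IH].
  by under eq_fun do rewrite ffactn0 expr0 divr1; exact: cvg_cst.
have lin : ((n - b - k)%N%:R / n%:R : R) @[n --> \oo] --> (1 : R).
  have h : (1 - (b + k)%:R * (n%:R)^-1 : R) @[n --> \oo] --> (1 : R).
    rewrite -[X in _ --> X]subr0 -[X in 1 - X](mulr0 (b + k)%:R).
    apply: cvgB; first exact: cvg_cst.
    by apply: cvgM; [exact: cvg_cst|exact: cvg_invn].
  apply: (cvg_trans _ h); apply: near_eq_cvg; near=> n.
  have bn : (b + k < n)%N by near: n; exact: nbhs_infty_gt.
  rewrite -subnDA natrB ?(ltnW bn)// mulrBl divff// pnatr_eq0 -lt0n.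
  exact: leq_ltn_trans bn.
have h : (((n - b) ^_ k)%:R / n%:R ^+ k * ((n - b - k)%N%:R / n%:R) : R)
    @[n --> \oo] --> (1 : R).
  by rewrite -[X in _ --> X]mulr1; exact: cvgM.
apply: (cvg_trans _ h); apply: near_eq_cvg.
near=> n; rewrite /= ffactnSr natrM exprSr invfM mulrACA.
by [].
Unshelve. all: by end_near. Qed.

(** Written with falling factorials, [n * alpha n c] is a constant times ratios tending to 1 times
    [n ^ -(c - 1)]. The last power survives only for [c = 1], where the constant is [m ^ 2]. *)
Lemma alpha_cvg c : (0 < c <= m)%N ->
  (n%:R * alpha R g n c) @[n --> \oo] -->
    ((c == 1%N)%:R * m%:R ^+ 2 : R).
Proof.
move=> /andP[c0 cm].
pose K : R := 'C(m, c)%:R * (m`!)%:R / ((m - c)`!)%:R.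
have f0 k : (k`!)%:R != 0 :> R by rewrite pnatr_eq0 -lt0n fact_gt0.
have main : (K * (((n - m) ^_ (m - c))%:R / n%:R ^+ (m - c)) *
    (((n - 0) ^_ m)%:R / n%:R ^+ m)^-1 * (n%:R ^-1) ^+ c.-1 : R) @[n --> \oo] -->
    (K * 1 * 1^-1 * 0 ^+ c.-1 : R).
  apply: cvgM; last exact: (cvg_comp _ _ cvg_invn (@exprn_continuous _ c.-1 0)).
  apply: cvgM; last by apply: cvgV; [exact: oner_neq0|exact: ffact_ratio_cvg].
  by apply: cvgM; [exact: cvg_cst|exact: ffact_ratio_cvg].
have -> : (c == 1%N)%:R * m%:R ^+ 2 = K * 1 * 1^-1 * 0 ^+ c.-1.
  rewrite invr1 !mulr1 expr0n; case: c c0 cm @K main => // -[|c] _ cm K _; last first.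
    by rewrite !mulr0 mul0r.
  rewrite !eqxx mul1r mulr1 /K bin1 subn1 /= [m`!]factS natrM.
  by rewrite expr2 -!mulrA mulfV ?mulr1// f0.
apply: (cvg_trans _ main); apply: near_eq_cvg; near=> n.
have mn : (m < n)%N by near: n; exact: nbhs_infty_gt.
rewrite /alpha subn0 exprVn.
have n0 : n%:R != 0 :> R by rewrite pnatr_eq0 -lt0n; exact: leq_ltn_trans mn.
have nm0 : (n ^_ m)%:R != 0 :> R by rewrite pnatr_eq0 -lt0n ffact_gt0 ltnW.
have -> : n%:R ^+ m = n%:R ^+ (m - c) * n%:R ^+ c.-1 * n%:R :> R.
  by rewrite -exprD -exprSr; congr (_ ^+ _); lia.
have p0 k : n%:R ^+ k != 0 :> R by rewrite expf_neq0.
have -> : 'C(n, m)%:R = (n ^_ m)%:R / (m`!)%:R :> R.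
  by rewrite -bin_ffact natrM mulfK.
rewrite natrM -/m.
have -> : 'C(n - m, m - c)%:R = ((n - m) ^_ (m - c))%:R / ((m - c)`!)%:R :> R.
  by rewrite -bin_ffact natrM mulfK.
rewrite /K; move: (p0 (m - c)%N) (p0 c.-1) (f0 m) (f0 (m - c)%N) nm0 n0.
move: (n%:R ^+ (m - c)) (n%:R ^+ c.-1) (m`!)%:R ((m - c)`!)%:R (n ^_ m)%:R.
move: 'C(m, c)%:R ((n - m) ^_ (m - c))%:R n%:R.
move=> a b N p s u v w p0' s0 u0 v0 w0 N0.
by field; rewrite p0' s0 u0 v0 w0 N0.
Unshelve. all: by end_near. Qed.

(** Vandermonde's identity, with the term [c = 0] moved to the right. *)
Lemma sum_alpha n : (m <= n)%N ->
  \sum_(1 <= c < m.+1) alpha R g n c = 1 - alpha R g n 0.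
Proof.
move=> mn.
have C0 : 'C(n, m)%:R != 0 :> R by rewrite pnatr_eq0 -lt0n bin_gt0.
apply/eqP; rewrite eq_sym subr_eq eq_sym; apply/eqP.
rewrite addrC -big_ltn// big_mkord -mulr_suml -natr_sum.
rewrite binomial.Vandermonde subnKC// divff//.
Qed.

End hypergeometric_weights.

(** * Truncation of real functions *)

Section clamp.
Context (R : realType).

Definition clamp (B x : R) := Num.max (- B) (Num.min x B).

Lemma clamp_id B x : `|x| <= B -> clamp B x = x.
Proof.
rewrite ler_norml => /andP[lo hi].
by rewrite /clamp (min_idPl hi) (max_idPr lo).
Qed.

Lemma norm_clamp_le B x : 0 <= B -> `|clamp B x| <= B.
Proof.
move=> B0; rewrite ler_norml /clamp le_max lexx /= ge_max ge_min lexx orbT.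
by rewrite andbT (le_trans _ B0)// oppr_le0.
Qed.

Lemma measurable_clamp d (T : measurableType d) (f : T -> R) B :
  measurable_fun [set: T] f -> measurable_fun [set: T] (fun x => clamp B (f x)).
Proof. by move=> mf; apply: measurable_maxr => //; exact: measurable_minr. Qed.

End clamp.

Section blocks.
Context d (T : measurableType d).

(** The label counterpart of the two blocks of arguments in [overlap]; the default 0 is not reached
    when [e + k <= l]. *)
Definition block k e l (t : l.-tuple nat) : k.-tuple nat :=
  [tuple nth 0%N t (e + i) | i < k].

Lemma first_of_obs k e l (t : l.-tuple nat) (z : nat -> T) : (e + k <= l)%N ->
  first_of k (drop e (obs t z)) = obs (block k e t) z.
Proof.
move=> ekl; apply: eq_from_tnth => i; rewrite !tnth_mktuple nth_drop val_obs.
by rewrite (nth_map 0%N)// size_tuple (leq_trans _ ekl)// ltn_add2l.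
Qed.

Lemma val_block k e l (t : l.-tuple nat) : (e + k <= l)%N ->
  block k e t = take k (drop e t) :> seq nat.
Proof.
move=> ekl; have ks : (k <= size (drop e t))%N.
  by rewrite size_drop size_tuple; lia.
apply: (@eq_from_nth _ 0%N); first by rewrite size_tuple size_takel.
move=> i; rewrite size_tuple => ik; rewrite nth_take// nth_drop.
by rewrite -[i]/(val (Ordinal ik)) -tnth_nth tnth_mktuple.
Qed.

Lemma uniq_block k e l (t : l.-tuple nat) : (e + k <= l)%N -> uniq t ->
  uniq (block k e t).
Proof. by move=> ekl ut; rewrite val_block// take_uniq// drop_uniq. Qed.

Lemma val_block_iota k e l : (e + k <= l)%N ->
  block k e (iota_tuple l 0) = iota e k :> seq nat.
Proof.
move=> ekl; rewrite val_block//= drop_iota take_iota add0n.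
by congr iota; lia.
Qed.

End blocks.

(** * Kernels evaluated along the sample *)

Section almost_sure_kernels.
Context d dT (Omega : measurableType d) (T : measurableType dT) (R : realType).
Context (Pr : probability Omega R) (P : probability T R).
Context (Z : nat -> {RV Pr >-> T}).
Hypotheses (indep : independent Z) (idist : identically_distributed P Z).

Lemma ae_U_stat k (f h : k.-tuple T -> R) n :
  {ae product_power P k, forall z, f z = h z} ->
  {ae Pr, forall w, U_stat f n (Z ^~ w) = U_stat h n (Z ^~ w)}.
Proof.
move=> fh.
have H : {ae Pr, forall w, forall s : k.-tuple 'I_n, uniq s ->
    f (obs (labels s) (Z ^~ w)) = h (obs (labels s) (Z ^~ w))}.
  apply: ae_forall_fin => s; case: (boolP (uniq s)) => us; last exact: aeW.
  have us' : uniq (labels s) by rewrite uniq_labels.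
  by apply: filterS (ae_obs indep idist us' fh) => w /= -> _.
apply: filterS H => w /= fhw; rewrite !U_statE; congr (_ / _).
by apply: eq_bigr => s us; exact: fhw.
Qed.

Lemma measurable_neq_set d' (U : measurableType d') (f h : U -> R) :
  measurable_fun [set: U] f -> measurable_fun [set: U] h ->
  measurable [set x | ~ (f x = h x)].
Proof.
move=> mf mh; rewrite (_ : [set _ | _] = [set x | 0 < `|f x - h x|]).
  apply: measurable_gt_set; apply: measurableT_comp => //.
  exact: measurable_funB.
apply/seteqP; split=> x /=; rewrite normr_gt0 subr_eq0; first by move/eqP.
by move=> /eqP.
Qed.

Context (g : nat) (Phi : g.-tuple T -> T -> R).
Let m := g.+1.
Hypotheses (mPhi : measurable_fun [set: _] (uncurried Phi))
  (inv : permutation_invariant Phi).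

(** Swapping position [i] with the last one turns every summand of [Phi0] into [Phi_tuple] at
    relabelled observations. Almost sure statements about [Phi_tuple] thus reach all summands. *)
Lemma Phi_at_permuted (i : 'I_m) (t : m.-tuple nat) : uniq t ->
  exists2 t' : m.-tuple nat, uniq t' & forall z : nat -> T,
    Phi (leave_out i (obs t z)) (tnth (obs t z) i) = Phi_tuple Phi (obs t' z).
Proof.
move=> /(elimT (tuple_uniqP _)) inj; pose p := tperm (ord_max : 'I_m) i.
exists [tuple tnth t (p j) | j < m].
  apply/(introT (tuple_uniqP _)) => j k; rewrite !tnth_mktuple => /inj.
  exact: perm_inj.
move=> z; have -> : obs [tuple tnth t (p j) | j < m] z =
    [tuple tnth (obs t z) (p j) | j < m].
  by apply: eq_from_tnth => j; rewrite !tnth_mktuple.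
have pi : p ord_max = i by rewrite tpermL.
have E : tnth [tuple tnth (obs t z) (p j) | j < m] ord_max = tnth (obs t z) i.
  by rewrite tnth_mktuple pi.
rewrite /Phi_tuple E; apply: inv; rewrite perm_sym.
have := leave_out_perm p ord_max (obs t z); rewrite pi; exact.
Qed.

Lemma overlap_obs (Psi : g.-tuple T -> T -> R) c (t : (2 * m - c).-tuple nat)
    (z : nat -> T) : (c <= m)%N -> @overlap _ _ _ _ Psi c (obs t z) =
  Phi0 Psi (obs (block m 0 t) z) * Phi0 Psi (obs (block m (m - c) t) z).
Proof.
move=> cm; rewrite /overlap -(first_of_obs (e := 0)) ?drop0; last by lia.
by rewrite -first_of_obs//; lia.
Qed.

Lemma expect_Phi_at (i : 'I_m) : (exists B, forall l x, `|Phi l x| <= B) ->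
  \int[product_power P m]_z Phi (leave_out i z) (tnth z i) = Delta Phi P.
Proof.
move=> [B PhiB].
have bi j : bmf (fun z : m.-tuple T => Phi (leave_out j z) (tnth z j)).
  by split; [exact: measurable_Phi_at|exists B].
have ui : uniq (iota_tuple m 0) by exact: iota_uniq.
have [t' ut' tE] := Phi_at_permuted i ui.
rewrite -(expect_obs indep idist ui (bi i)).
under eq_Rintegral do rewrite tE.
exact: (expect_obs indep idist ut' (bi ord_max)).
Qed.

Lemma bmf_Phi0 : (exists B, forall l x, `|Phi l x| <= B) -> bmf (Phi0 Phi).
Proof.
move=> [B PhiB]; apply: bmfM; first exact: bmf_cst.
apply: bmf_sum => i _; split; first exact: measurable_Phi_at.
by exists B.
Qed.

Lemma int_Phi0 : (exists B, forall l x, `|Phi l x| <= B) ->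
  \int[product_power P m]_z Phi0 Phi z = Delta Phi P.
Proof.
move=> bPhi; rewrite /Phi0 bmf_intZ; last first.
  apply: bmf_sum => i _; split; first exact: measurable_Phi_at.
  by have [B PhiB] := bPhi; exists B.
rewrite bmf_int_sum; last first.
  move=> i _; split; first exact: measurable_Phi_at.
  by have [B PhiB] := bPhi; exists B.
rewrite (eq_bigr (fun=> Delta Phi P)); last by move=> i _; exact: expect_Phi_at.
by rewrite sumr_const card_ord -[Delta _ _ *+ _]mulr_natl mulKf// pnatr_eq0.
Qed.

Lemma bmf_overlap c : (c <= m)%N -> (exists B, forall l x, `|Phi l x| <= B) ->
  bmf (@overlap _ _ _ _ Phi c).
Proof.
move=> cm bPhi; split; first exact: measurable_overlap.
have [_ [B PB]] := bmf_Phi0 bPhi; exists (B * B) => z.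
by rewrite normrM ler_pM.
Qed.

Lemma kappa_obs c : (c <= m)%N -> (exists B, forall l x, `|Phi l x| <= B) ->
  exists s t : m.-tuple nat, [/\ s = iota 0 m :> seq nat,
    t = iota (m - c) m :> seq nat & kappa Phi P c =
    \int[Pr]_w (Phi0 Phi (obs s (Z ^~ w)) * Phi0 Phi (obs t (Z ^~ w)))].
Proof.
move=> cm bPhi; pose r := iota_tuple (2 * m - c) 0.
exists (block m 0 r), (block m (m - c) r); split.
- by rewrite val_block_iota//; lia.
- by rewrite val_block_iota//; lia.
- have ur : uniq r by exact: iota_uniq.
  rewrite /kappa -(expect_obs indep idist ur (bmf_overlap cm bPhi)).
  by apply: eq_Rintegral => w _; rewrite overlap_obs.
Qed.

Lemma kappa0E : (exists B, forall l x, `|Phi l x| <= B) ->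
  kappa Phi P 0 = Delta Phi P ^+ 2.
Proof.
move=> bPhi; have [s [t [sE tE ->]]] := kappa_obs (leq0n m) bPhi.
rewrite (expect_disjoint indep idist (bmf_Phi0 bPhi) (bmf_Phi0 bPhi)).
  by rewrite int_Phi0.
rewrite sE tE subn0 (_ : iota 0 m ++ iota m m = iota 0 (m + m)).
  exact: iota_uniq.
by rewrite iotaD add0n.
Qed.

(** The blocks [0, ..., g] and [g, ..., 2g] share the label [g], which symmetry moves to the front
    of the first block. *)
Lemma kappa1E : (exists B, forall l x, `|Phi l x| <= B) ->
  kappa Phi P 1 = \int[P]_x (first_projection P (Phi0 Phi) x ^+ 2).
Proof.
move=> bPhi; have [s [t [sE tE ->]]] := @kappa_obs 1 isT bPhi.
pose s' := iota_tuple g 0; pose t' := iota_tuple g g.+1.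
have tE' : t = [tuple of g :: t'].
  by apply: val_inj; rewrite /= tE /m subn1.
have <- := @expect_share_one _ _ _ _ _ _ P Z indep idist g (Phi0 Phi) g s' t'
  (bmf_Phi0 bPhi).
  apply: eq_Rintegral => w _; congr (_ * _).
    apply: symmetric_Phi0 => //; rewrite !val_obs; apply: perm_map.
    have e1 : perm_eq (iota 0 (g + 1)) (g :: iota 0 g).
      by rewrite iotaD add0n perm_catC.
    by rewrite addn1 in e1; rewrite sE.
  by rewrite tE'.
rewrite cons_uniq cat_uniq !iota_uniq andbT mem_cat !mem_iota.
apply/andP; split; first by lia.
by apply/hasPn => x; rewrite !mem_iota; lia.
Qed.

End almost_sure_kernels.

(** * Passage to the truncated kernel *)

Section clamped_kernel.
Context d dT (Omega : measurableType d) (T : measurableType dT) (R : realType).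
Context (Pr : probability Omega R) (P : probability T R).
Context (Z : nat -> {RV Pr >-> T}).
Hypotheses (indep : independent Z) (idist : identically_distributed P Z).
Context (g : nat) (Phi : g.-tuple T -> T -> R).
Let m := g.+1.
Hypotheses (mPhi : measurable_fun [set: _] (uncurried Phi))
  (inv : permutation_invariant Phi).
Variable B : R.
Hypothesis aeB : {ae product_power P m, forall z, `|Phi_tuple Phi z| <= B}.

(** The level is [|B|] because the sign of an almost sure bound is not known a priori. *)
Definition clamped (l : g.-tuple T) (x : T) : R := clamp `|B| (Phi l x).

Lemma clamped_bounded : exists C, forall l x, `|clamped l x| <= C.
Proof. by exists `|B| => l x; exact: norm_clamp_le. Qed.

Lemma measurable_clamped : measurable_fun [set: _] (uncurried clamped).
Proof. exact: (measurable_clamp _ mPhi). Qed.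

Lemma clamped_invariant : permutation_invariant clamped.
Proof. by move=> l l' x ll'; rewrite /clamped (inv _ ll'). Qed.

Lemma ae_clamped : {ae product_power P m, forall z,
  Phi_tuple clamped z = Phi_tuple Phi z}.
Proof.
apply: filterS aeB => z /= zB; apply: clamp_id.
exact: le_trans (ler_norm B).
Qed.

Lemma Delta_clamped : Delta Phi P = Delta clamped P.
Proof.
apply: ae_eq_Rintegral.
- exact: (measurable_Phi_at ord_max mPhi).
- exact: (measurable_Phi_at ord_max measurable_clamped).
- by apply: filterS ae_clamped => z /= ->.
Qed.

Lemma ae_Phi0_clamped_obs (t : m.-tuple nat) : uniq t ->
  {ae Pr, forall w, Phi0 Phi (obs t (Z ^~ w)) = Phi0 clamped (obs t (Z ^~ w))}.
Proof.
move=> ut.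
have H : {ae Pr, forall w, forall i : 'I_m,
    Phi (leave_out i (obs t (Z ^~ w))) (tnth (obs t (Z ^~ w)) i) =
    clamped (leave_out i (obs t (Z ^~ w))) (tnth (obs t (Z ^~ w)) i)}.
  apply: ae_forall_fin => i.
  have [t' ut' tE] := Phi_at_permuted inv i ut.
  apply: filterS (ae_obs indep idist ut' ae_clamped) => w /= E.
  rewrite /clamped tE; exact: esym E.
by apply: filterS H => w /= E; rewrite /Phi0; under eq_bigr do rewrite E.
Qed.

Lemma ae_Phi0_clamped :
  {ae product_power P m, forall z, Phi0 Phi z = Phi0 clamped z}.
Proof.
have ui : uniq (iota_tuple m 0) by exact: iota_uniq.
apply: (ae_obsE indep idist ui); last exact: ae_Phi0_clamped_obs.
by apply: measurable_neq_set; apply: measurable_Phi0 => //;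
  exact: measurable_clamped.
Qed.

Lemma ae_overlap_clamped c : (c <= m)%N ->
  {ae product_power P (2 * m - c), forall z,
    @overlap _ _ _ _ Phi c z = @overlap _ _ _ _ clamped c z}.
Proof.
move=> cm; have ui : uniq (iota_tuple (2 * m - c) 0) by exact: iota_uniq.
apply: (ae_obsE indep idist ui).
  by apply: measurable_neq_set; apply: measurable_overlap => //;
    exact: measurable_clamped.
have u1 : uniq (block m 0 (iota_tuple (2 * m - c) 0)).
  by apply: uniq_block => //; lia.
have u2 : uniq (block m (m - c) (iota_tuple (2 * m - c) 0)).
  by apply: uniq_block => //; lia.
apply: filterS2 (ae_Phi0_clamped_obs u1) (ae_Phi0_clamped_obs u2) => w /= E1 E2.
by rewrite !overlap_obs// E1 E2.
Qed.

Lemma kappa_clamped c : (c <= m)%N -> kappa Phi P c = kappa clamped P c.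
Proof.
move=> cm; apply: ae_eq_Rintegral.
- exact: measurable_overlap.
- by apply: measurable_overlap => //; exact: measurable_clamped.
- exact: ae_overlap_clamped.
Qed.

(** The law of large numbers holds for the truncated kernel, whose estimator and parameter agree
    almost surely with the original ones. *)
Lemma kappa_hat_cvg c : (c <= m)%N ->
  cvg_prob Pr (fun n w => kappa_hat Phi c n (Z ^~ w)) (kappa Phi P c).
Proof.
move=> cm; have bov := bmf_overlap measurable_clamped cm clamped_bounded.
rewrite kappa_clamped//.
apply: (cvg_prob_ae (X := fun n w => kappa_hat clamped c n (Z ^~ w))).
- by move=> n; apply: measurable_U_stat; exact: measurable_overlap.
- move=> n; apply: (ae_U_stat indep idist).
  by apply: filterS (ae_overlap_clamped cm) => z /= ->.
- have [K hK] := U_stat_law_of_large_numbers indep idist bov.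
  apply: (cvg_prob_second_moment (K := K) (N := (2 * (2 * m - c))%N)) => //.
  by move=> n; apply: bmfB; [exact: bmf_U_stat|exact: bmf_cst].
Qed.

End clamped_kernel.

(** * Central limit theorem *)

Section standardized_sum.
Context d dT (Omega : measurableType d) (T : measurableType dT) (R : realType).
Context (Pr : probability Omega R) (P : probability T R).
Context (Z : nat -> {RV Pr >-> T}).
Hypotheses (indep : independent Z) (idist : identically_distributed P Z).
Variable q : T -> R.
Hypotheses (bq : bmf q) (q_mean : \int[P]_x q x = 0)
  (q_var : \int[P]_x (q x ^+ 2) = 1).

Definition standardized_sum (n : nat) (w : Omega) : R :=
  (Num.sqrt n%:R)^-1 * \sum_(j < n) q (Z j w).

Lemma bmf_standardized_sum n : bmf (standardized_sum n).
Proof.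
apply: bmfM; first exact: bmf_cst.
by apply: bmf_sum => j _; apply: bmf_comp bq.
Qed.

(** With steps [a = n^(-1/2)] the elapsed time [n * a ^+ 2] is 1, and the accumulated error
    [n * C * a ^+ 3] is [C * a]. *)
Lemma standardized_sum_smooth (s y : R) : 0 < s ->
  \int[Pr]_w ncdf ((Num.sqrt s)^-1 * (y - standardized_sum n w)) @[n --> \oo] -->
  ncdf ((Num.sqrt (1 + s))^-1 * y).
Proof.
move=> s0; have [C C0 hC] := lindeberg_iterate bq q_mean q_var s0.
apply/cvgrPdist_le => e e0; near=> n.
have n0 : (0 < n)%N by near: n; exact: nbhs_infty_gt.
have n0R : 0 < n%:R :> R by rewrite ltr0n.
pose a : R := (Num.sqrt n%:R)^-1.
have a0 : 0 < a by rewrite invr_gt0 sqrtr_gt0.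
have a1 : a <= 1.
  rewrite invf_le1 ?sqrtr_gt0// -[leLHS]sqrtr1 ler_wsqrtr//.
  by rewrite ler1n.
have a2 : n%:R * a ^+ 2 = 1 by rewrite exprVn sqr_sqrtr ?ltW// divff// gt_eqF.
have a01 : 0 < a <= 1 by rewrite a0.
have := hC a n s y a01 (lexx _); rewrite a2 [s + 1]addrC.
have -> : n%:R * C * a ^+ 3 = C * a.
  rewrite (_ : _ * _ * _ = n%:R * a ^+ 2 * (C * a)); last by ring.
  by rewrite a2 mul1r.
have ui : uniq (iota_tuple n 0) by exact: iota_uniq.
have bF : bmf (fun z : n.-tuple T =>
    ncdf ((Num.sqrt s)^-1 * (y - a * \sum_(i < n) q (tnth z i)))).
  apply: bmf_ncdf; apply: measurable_funM => //; apply: measurable_funB => //.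
  apply: measurable_funM => //; apply: measurable_sum => i.
  by case: (bmf_tnth i bq).
rewrite -(expect_obs indep idist ui bF) distrC.
rewrite (_ : \int[Pr]_w _ = \int[Pr]_w ncdf ((Num.sqrt s)^-1 *
    (y - standardized_sum n w))); last first.
  apply: eq_Rintegral => w _; congr (ncdf (_ * (_ - _ * _))).
  apply: eq_bigr => i _; rewrite tnth_mktuple (tnth_nth 0%N) /= nth_iota//.
move=> /le_trans; apply; rewrite ler_pdivrMr ?sqrtr_gt0// -ler_pdivrMl//.
rewrite mulrC -[leLHS]ger0_norm; last by rewrite divr_ge0// ltW.
rewrite -sqrtr_sqr ler_wsqrtr//.
by near: n; exact: nbhs_infty_ger.
Unshelve. all: by end_near. Qed.

Lemma standardized_sum_second_moment : exists (K : R) (N : nat), forall n,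
  (N <= n)%N -> \int[Pr]_w (standardized_sum n w ^+ 2) <= K.
Proof.
(* The sample mean of [q] is a U-statistic of order one, and the squared standardized sum is [n]
   times its square. *)
pose psi (x : 1.-tuple T) := \sum_(i < 1) q (tnth x i).
have bpsi : bmf psi by apply: bmf_sum => i _; exact: bmf_tnth.
have psi0 : \int[product_power P 1]_x psi x = 0.
  rewrite bmf_int_sum; last by move=> i _; exact: bmf_tnth.
  by rewrite big1// => i _; rewrite product_power_marginal.
have [K hK] := U_stat_law_of_large_numbers indep idist bpsi.
exists K, 2%N => n n2; apply: le_trans (hK n n2); rewrite psi0.
have n0 : 0 < n%:R :> R by rewrite ltr0n; exact: leq_trans n2.
rewrite -bmf_intZ; last first.
  by apply: bmfM; apply: bmfB; (exact: bmf_U_stat || exact: bmf_cst).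
rewrite le_eqVlt; apply/orP; left; apply/eqP; apply: eq_Rintegral => w _.
rewrite /psi U_stat_linear; [|exact: leq_trans n2..].
rewrite subr0 /standardized_sum !exprMn exprVn sqr_sqrtr ?(ltW n0)//.
by field; rewrite gt_eqF.
Qed.

End standardized_sum.

(** * Consistency of the variance estimates *)

Section studentization.
Context d dT (Omega : measurableType d) (T : measurableType dT) (R : realType).
Context (Pr : probability Omega R) (P : probability T R).
Context (Z : nat -> {RV Pr >-> T}).
Hypotheses (indep : independent Z) (idist : identically_distributed P Z).
Context (g : nat) (Phi : g.-tuple T -> T -> R).
Let m := g.+1.
Hypotheses (mPhi : measurable_fun [set: _] (uncurried Phi))
  (inv : permutation_invariant Phi) (bounded : as_bounded Phi P)
  (nondeg : kappa Phi P 1 <> Delta_sq Phi P).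

Let v : R := m%:R ^+ 2 * (kappa Phi P 1 - Delta_sq Phi P).

Lemma variance_estimate_cvg (u : nat -> (nat -> T) -> R) :
  [\/ u = u_exact Phi P, u = u_plugin Phi | u = v_hat Phi] ->
  cvg_prob Pr (fun n w => n%:R * u n (Z ^~ w)) v.
Proof.
have [B aeB] := bounded.
have cvgk c := @kappa_hat_cvg _ _ _ _ _ _ _ _ indep idist _ _ mPhi inv _ aeB c.
have cvgdiff c : (c <= m)%N -> cvg_prob Pr (fun n w =>
    kappa_hat Phi c n (Z ^~ w) + (-1) * Delta_sq_hat Phi n (Z ^~ w))
    (kappa Phi P c + (-1) * Delta_sq Phi P).
  move=> cm; apply: cvg_probD; first exact: cvgk.
  by apply: cvg_probM; [exact: cvg_prob_cst|exact: cvgk].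
have cvg1 : cvg_prob Pr (fun n w => m%:R ^+ 2 *
    (kappa_hat Phi 1 n (Z ^~ w) + (-1) * Delta_sq_hat Phi n (Z ^~ w))) v.
  rewrite /v -[- Delta_sq _ _]mulN1r.
  by apply: cvg_probM; [exact: cvg_prob_cst|exact: cvgdiff].
case=> ->.
- apply: (cvg_prob_map (N := 1%N) _ _ (cvg_prob_cst Pr v)).
    by move=> n; rewrite /u_exact.
  move=> e e0; exists 1 => // n w n1 _; rewrite /u_exact -/m -/v mulrC divfK.
    by rewrite subrr normr0 ltW.
  by rewrite pnatr_eq0 -lt0n.
- have mu n : measurable_fun [set: Omega]
      (fun w => n%:R * u_plugin Phi n (Z ^~ w)).
    apply: measurable_funM => //; apply: measurable_funM => //.
    apply: measurable_funM => //; apply: measurable_funB.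
      by have [h _] := cvgk 1%N isT; exact: h.
    by have [h _] := cvgk 0%N isT; exact: h.
  apply: (cvg_prob_map (N := 1%N) mu _ cvg1) => e e0; exists e => // n w n1.
  rewrite /u_plugin -/m mulN1r [n%:R * _]mulrC divfK//.
  by rewrite pnatr_eq0 -lt0n.
- have mu n : measurable_fun [set: Omega]
      (fun w => n%:R * v_hat Phi n (Z ^~ w)).
    apply: measurable_funM => //; apply: measurable_funB.
      rewrite (_ : (fun _ => _) = (fun w => \sum_(i < m)
        alpha R g n i.+1 * kappa_hat Phi i.+1 n (Z ^~ w))).
        apply: measurable_sum => i; apply: measurable_funM => //.
        by have [h _] := cvgk i.+1 (ltn_ord i); exact: h.
      by apply/funext => w; rewrite big_add1 big_mkord.
    by apply: measurable_funM => //; have [h _] := cvgk 0%N isT; exact: h.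
  (* Since the weights with [c >= 1] sum to [1 - alpha n 0], [v_hat] is the weighted sum of the
     differences [kappa_hat c - Delta_sq_hat] as soon as [m <= n]. *)
  have cvgsum : cvg_prob Pr (fun n w => \sum_(i < m) (n%:R * alpha R g n i.+1) *
      (kappa_hat Phi i.+1 n (Z ^~ w) + (-1) * Delta_sq_hat Phi n (Z ^~ w))) v.
    have -> : v = \sum_(i < m) ((i.+1 == 1%N)%:R * m%:R ^+ 2) *
        (kappa Phi P i.+1 + (-1) * Delta_sq Phi P).
      rewrite big_ord_recl /= mul1r big1 ?addr0 ?mulN1r//.
      by move=> i _; rewrite !mul0r.
    apply: cvg_prob_sum => i; apply: cvg_probM; last exact: cvgdiff.
    by apply: cvg_prob_seq; apply: alpha_cvg; rewrite /= ltn_ord.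
  apply: (cvg_prob_map (N := m) mu _ cvgsum) => e e0; exists e => // n w mn.
  rewrite /v_hat -/m -sum_alpha// !big_add1 !big_mkord.
  rewrite mulr_suml -sumrB mulr_sumr.
  by congr (`|_ - _| <= _); apply: eq_bigr => i _; ring.
Qed.

End studentization.

(** * The studentized limit theorem *)

Section clt_for_U_statistic.
Context d dT (Omega : measurableType d) (T : measurableType dT) (R : realType).
Context (Pr : probability Omega R) (P : probability T R).
Context (Z : nat -> {RV Pr >-> T}).
Hypotheses (indep : independent Z) (idist : identically_distributed P Z).

Lemma studentizer_cvg (u W : nat -> Omega -> R) (v : R) (N : nat) : 0 < v ->
  (forall n, measurable_fun [set: Omega] (W n)) ->
  (forall n w, (N <= n)%N -> 0 < u n w -> W n w = (Num.sqrt (u n w))^-1) ->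
  cvg_prob Pr (fun n w => n%:R * u n w) v ->
  cvg_prob Pr (fun n w => Num.sqrt v / Num.sqrt n%:R * W n w) 1.
Proof.
move=> v0 mW WE cv.
apply: (cvg_prob_map (N := maxn N 1) _ _ cv).
  by move=> n; apply: measurable_funM.
(* The bound [v / 2] forces [n * u >= v / 2 > 0], where [W] is the inverse square root; the other
   makes the quotient below at most [e], its denominator being at least [v / 2]. *)
move=> e e0; exists (Num.min (v / 2) (e * v / 2)).
  by rewrite lt_min !divr_gt0// mulr_gt0.
move=> n w; rewrite geq_max => /andP[Nn n1]; rewrite le_min => /andP[V1 V2].
have n0 : 0 < n%:R :> R by rewrite ltr0n.
set V := n%:R * u n w in V1 V2.
have [V3 V4] : v / 2 <= V /\ 0 < V.
  by move: V1; rewrite ler_norml => /andP[? ?]; split; lra.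
have u0 : 0 < u n w by rewrite -(pmulr_rgt0 _ n0).
have sv0 : 0 < Num.sqrt v by rewrite sqrtr_gt0.
have sV0 : 0 < Num.sqrt V by rewrite sqrtr_gt0.
have svv : Num.sqrt v ^+ 2 = v by rewrite sqr_sqrtr// ltW.
have sVV : Num.sqrt V ^+ 2 = V by rewrite sqr_sqrtr// ltW.
have -> : Num.sqrt v / Num.sqrt n%:R * W n w = Num.sqrt v / Num.sqrt V.
  by rewrite WE// /V sqrtrM ?ltW// invfM mulrA.
rewrite (_ : _ - 1 = (v - V) / (Num.sqrt V * (Num.sqrt v + Num.sqrt V))); last first.
  rewrite -{2}svv -{2}sVV; field.
  by rewrite !gt_eqF ?addr_gt0.
have den0 : 0 < Num.sqrt V * (Num.sqrt v + Num.sqrt V).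
  by rewrite mulr_gt0// addr_gt0.
rewrite normrM normfV (gtr0_norm den0) ler_pdivrMr// distrC.
apply: le_trans V2 _; rewrite -mulrA ler_wpM2l ?ltW//.
by rewrite mulrDr -expr2 sVV; have := mulr_gt0 sV0 sv0; lra.
Qed.

Context (g : nat) (Phi : g.-tuple T -> T -> R).
Let m := g.+1.
Hypotheses (mPhi : measurable_fun [set: _] (uncurried Phi))
  (inv : permutation_invariant Phi) (bounded : as_bounded Phi P)
  (nondeg : kappa Phi P 1 <> Delta_sq Phi P).

(** [W] stands for [u^(-1/2)] with an arbitrary measurable choice where [u <= 0]; that event has
    vanishing probability. *)
Theorem clt_Delta_hat (u : nat -> (nat -> T) -> R)
  (hu : [\/ u = u_exact Phi P, u = u_plugin Phi | u = v_hat Phi])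
  (W : nat -> Omega -> R) (N : nat)
  (mW : forall n, measurable_fun [set: Omega] (W n))
  (WE : forall n w, (N <= n)%N -> 0 < u n (Z ^~ w) ->
     W n w = (Num.sqrt (u n (Z ^~ w)))^-1) :
  cvg_in_distribution Pr
    (fun n w => (Delta_hat Phi n (Z ^~ w) - Delta Phi P) * W n w)
    (normal_prob 0 1).
Proof.
have cu := variance_estimate_cvg indep idist mPhi inv bounded hu.
have [B aeB] := bounded.
set Psi := clamped Phi B.
have mPsi : measurable_fun [set: _] (uncurried Psi) := measurable_clamped mPhi B.
have bPsi : exists C, forall l x, `|Psi l x| <= C := clamped_bounded Phi B.
have iPsi : permutation_invariant Psi := clamped_invariant inv B.
pose phi := Phi0 Psi.
have bphi : bmf phi := bmf_Phi0 mPsi bPsi.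
have sphi : symmetric_kernel phi := symmetric_Phi0 iPsi.
pose h := centered_projection P phi.
have bh : bmf h := bmf_centered_projection P bphi.
pose v0 := kappa Phi P 1 - Delta_sq Phi P.
have Dphi : \int[product_power P m]_z phi z = Delta Phi P.
  by rewrite (Delta_clamped mPhi aeB) (int_Phi0 indep idist).
have v0E : \int[P]_x (h x ^+ 2) = v0.
  rewrite int_centered_projection_sqr// -(kappa1E indep idist mPsi iPsi bPsi).
  rewrite Dphi (Delta_clamped mPhi aeB) -(kappa0E indep idist mPsi iPsi bPsi).
  by rewrite -!(kappa_clamped indep idist mPhi inv aeB).
(* As the integral of a square [v0] is nonnegative, and non-degeneracy excludes 0. *)
have v00 : 0 < v0.
  rewrite lt_neqAle eq_sym subr_eq0; apply/andP; split; first exact/eqP.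
  by rewrite -v0E; apply: Rintegral_ge0 => x _; exact: sqr_ge0.
pose s := Num.sqrt v0.
have s0 : 0 < s by rewrite sqrtr_gt0.
have s2 : s ^+ 2 = v0 by rewrite sqr_sqrtr// ltW.
pose q x := s^-1 * h x.
have bq : bmf q by apply: bmfM => //; exact: bmf_cst.
have q_mean : \int[P]_x q x = 0.
  by rewrite bmf_intZ// int_centered_projection// mulr0.
have q_var : \int[P]_x (q x ^+ 2) = 1.
  rewrite (_ : (fun x => q x ^+ 2) = (fun x => v0^-1 * h x ^+ 2)).
    by rewrite bmf_intZ ?v0E ?mulVf ?gt_eqF//; exact: bmfM.
  by apply/funext => x; rewrite exprMn exprVn s2.
pose S := standardized_sum Z q.
have bS n : bmf (S n) by exact: bmf_standardized_sum.
pose A n w := Num.sqrt n%:R / (m%:R * s) * (Delta_hat Phi n (Z ^~ w) - Delta Phi P).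
pose A' n w := Num.sqrt n%:R / (m%:R * s) * (U_stat phi n (Z ^~ w) - Delta Phi P).
have mDelta n : measurable_fun [set: Omega] (fun w => Delta_hat Phi n (Z ^~ w)).
  under eq_fun do rewrite (Delta_hatE _ _ inv).
  by apply: measurable_U_stat; exact: measurable_Phi0.
have mA n : measurable_fun [set: Omega] (A n).
  by apply: measurable_funM => //; exact: measurable_funB.
have ms0 : m%:R * s != 0 by rewrite mulf_neq0 ?gt_eqF// pnatr_eq0.
(* The difference is [sqrt n / (m * s)] times the Hoeffding remainder, whose second moment is
   O(n^-2). *)
have cA'S : cvg_prob Pr (fun n w => A' n w - S n w) 0.
  have [K hK] := hajek_projection indep idist bphi sphi.
  apply: (cvg_prob_second_moment (K := (m%:R * s) ^- 2 * K) (N := (2 * m)%N)).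
    move=> n; apply: bmfB; last exact: bmf_cst.
    apply: bmfB => //; apply: bmfM; first exact: bmf_cst.
    by apply: bmfB; [exact: bmf_U_stat|exact: bmf_cst].
  move=> n mn; have n0 : 0 < n%:R :> R by rewrite ltr0n; lia.
  have sn0 : 0 < Num.sqrt n%:R :> R by rewrite sqrtr_gt0.
  pose Rm w := U_stat phi n (Z ^~ w) - Delta Phi P -
    m%:R / n%:R * \sum_(j < n) h (Z j w).
  have bRm : bmf Rm.
    apply: bmfB; first by apply: bmfB; [exact: bmf_U_stat|exact: bmf_cst].
    apply: bmfM; first exact: bmf_cst.
    by apply: bmf_sum => j _; apply: bmf_comp bh.
  have E w : (A' n w - S n w - 0) ^+ 2 = (m%:R * s) ^- 2 * (n%:R * Rm w ^+ 2).
    rewrite /A' /S /standardized_sum /q -mulr_sumr /Rm.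
    have nE : n%:R = Num.sqrt n%:R ^+ 2 :> R by rewrite sqr_sqrtr// ltW.
    move: (Num.sqrt n%:R) sn0 nE => sn sn0 ->.
    move: (\sum_(i < n) _) (U_stat _ _ _ - _) ms0 => x y.
    rewrite mulf_eq0 negb_or => /andP[m0 _].
    by field; rewrite (gt_eqF s0) (gt_eqF sn0) m0.
  under eq_Rintegral do rewrite E.
  have bRm2 : bmf (fun w => Rm w ^+ 2) by exact: bmfM.
  have bnRm2 : bmf (fun w => n%:R * Rm w ^+ 2) by apply: bmfM => //; exact: bmf_cst.
  rewrite !bmf_intZ// mulrCA ler_wpM2l ?invr_ge0 ?sqr_ge0// mulrA -expr2.
  by have := hK n mn; rewrite Dphi.
have cAS : cvg_prob Pr (fun n w => A n w - S n w) 0.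
  apply: (cvg_prob_ae _ _ cA'S).
    by move=> n; apply: measurable_funB => //; case: (bS n).
  move=> n; have fh : {ae product_power P m, forall z, phi z = Phi0 Phi z}.
    by apply: filterS (ae_Phi0_clamped indep idist mPhi inv aeB) => z /= ->.
  apply: filterS (ae_U_stat indep idist n fh) => w /= E.
  by rewrite /A /A' E Delta_hatE.
pose v := m%:R ^+ 2 * v0.
have vgt0 : 0 < v by rewrite mulr_gt0// exprn_gt0// ltr0n.
have cW := studentizer_cvg vgt0 mW WE cu.
have [K [N' hK]] := standardized_sum_second_moment indep idist bq q_mean.
have cTS := slutsky bS hK cAS cW mA.
apply: (cvg_in_distribution_normal (S := S)).
- by move=> n; case: (bS n).
- by move=> n; apply: measurable_funM => //; exact: measurable_funB.
- move=> t y t0.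
  exact: (@standardized_sum_smooth _ _ _ _ _ _ _ _ indep idist _
    bq q_mean q_var t y t0).
(* The factors [sqrt n] in [A] and in the studentizer cancel once [n >= 1]. *)
apply: (cvg_prob_map (N := 1%N) _ _ cTS).
  move=> n; apply: measurable_funB; last by case: (bS n).
  by apply: measurable_funM => //; exact: measurable_funB.
move=> e e0; exists e => // n w n1.
have n0 : 0 < n%:R :> R by rewrite ltr0n.
have sn0 : 0 < Num.sqrt n%:R :> R by rewrite sqrtr_gt0.
suff -> : A n w * (Num.sqrt v / Num.sqrt n%:R * W n w) =
  (Delta_hat Phi n (Z ^~ w) - Delta Phi P) * W n w by [].
have -> : Num.sqrt v = m%:R * s.
  by rewrite /v sqrtrM ?sqr_ge0// sqrtr_sqr ger0_norm.
by rewrite /A; field; rewrite (gt_eqF s0) (gt_eqF sn0) -natr1 natr1 pnatr_eq0.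
Qed.

End clt_for_U_statistic.

Theorem theorem4p1 (R : realType) (r : nat) (hr : (0 < r)%N)
  (Yset : set R) (y0 : Yset)
  (X := (r.-1).-tuple R) (Y := response y0)
  (P : probability (X * Y)%type R) (hP : discrete_snd P)
  (L : Y * Y -> R) (hL : measurable_fun [set: Y * Y] L)
  (g : nat) (fM fM' : g.-tuple (X * Y) * X -> Y)
  (hfM : measurable_fun [set: g.-tuple (X * Y) * X] fM)
  (hfM' : measurable_fun [set: g.-tuple (X * Y) * X] fM')
  (sfM : symmetric_learner fM) (sfM' : symmetric_learner fM')
  (Phi := loss_difference L fM fM')
  (hbounded : as_bounded Phi P)
  (hnondeg : forall c : nat, (1 <= c <= g.+1)%N ->
     kappa Phi P c <> Delta_sq Phi P)
  (d : measure_display) (Omega : measurableType d) (Pr : probability Omega R)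
  (Z : nat -> {RV Pr >-> (X * Y)%type})
  (hindep : independent Z) (hdist : identically_distributed P Z)
  (u : nat -> (nat -> (X * Y)%type) -> R)
  (hu : [\/ u = u_exact Phi P, u = u_plugin Phi | u = v_hat Phi])
  (W : nat -> Omega -> R)
  (hWmeas : forall n, measurable_fun [set: Omega] (W n))
  (hW : forall n w, (2 * g + 2 <= n)%N -> 0 < u n (Z ^~ w) ->
     W n w = (Num.sqrt (u n (Z ^~ w)))^-1) :
  cvg_in_distribution Pr
    (fun n w => (Delta_hat Phi n (Z ^~ w) - Delta Phi P) * W n w)
    (normal_prob 0 1).
Proof.
(* Symmetry under permutations of positions is restated for rearranged training tuples. *)
have learner_perm (f : g.-tuple (X * Y) * X -> Y) : symmetric_learner f ->
    forall (l l' : g.-tuple (X * Y)) x, perm_eq l l' -> f (l, x) = f (l', x).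
  move=> sf l l' x /tuple_permP[p lp].
  by rewrite -(sf p l' x); congr (f (_, x)); apply: val_inj.
apply: (clt_Delta_hat hindep hdist _ _ hbounded _ hu hWmeas hW).
- have mloss (f : g.-tuple (X * Y) * X -> Y) :
      measurable_fun [set: g.-tuple (X * Y) * X] f ->
      measurable_fun [set: g.-tuple (X * Y) * (X * Y)]
        (fun p => L (f (p.1, p.2.1), p.2.2)).
    move=> mf; apply: (@measurableT_comp _ _ _ _ _ _ L _
      (fun p => (f (p.1, p.2.1), p.2.2))) => //.
    apply: measurable_fun_pair => /=.
      apply: (@measurableT_comp _ _ _ _ _ _ f _ (fun p => (p.1, p.2.1))) => //.
      by apply: measurable_fun_pair => //=; exact: measurableT_comp.
    by apply: measurableT_comp.
  by apply: measurable_funB; exact: mloss.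
- by move=> l l' x ll'; rewrite /Phi /loss_difference !(learner_perm _ _ l l').
- exact: hnondeg.
Qed.
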